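(* Fix an integer $r \geq 2$ and let $\mathbf H_n = (H_n^{(1)}, H_n^{(2)})$, $n\ge 1$, be a sequence of 2-hypermultiplexes, where both $H_n^{(1)}$ and $H_n^{(2)}$ are $r$-uniform. Suppose the vertices of $\mathbf H_n$ are colored uniformly at random with $c_n$ colors, where $c_n\to\infty$, such that $$\lim_{n \to \infty} \mathbb{E}[\mathbf T(\mathbf H_n)] = \begin{pmatrix} \lambda_1 \\ \lambda_2 \end{pmatrix} \quad\text{and}\quad \lim_{n \to \infty} \mathrm{Var}[\mathbf T(\mathbf H_n)] = \begin{pmatrix} \lambda_1 & \lambda_{1,2} \\ \lambda_{1,2} & \lambda_2 \end{pmatrix},$$ for constants $\lambda_1, \lambda_2, \lambda_{1,2} \geq 0$ with $\lambda_{1,2} \le \lambda_1$ and $\lambda_{1,2} \le \lambda_2$. Then, as $n\to\infty$, $\mathbf T(\mathbf H_n)$ converges in distribution to $$\begin{pmatrix} Z_1 + Z_{1,2} \\ Z_2 + Z_{1,2} \end{pmatrix},$$ where $Z_1 \sim \mathrm{Pois}(\lambda_1 - \lambda_{1,2})$, $Z_2 \sim \mathrm{Pois}(\lambda_2 - \lambda_{1,2})$, and $Z_{1,2} \sim \mathrm{Pois}(\lambda_{1,2})$ are independent.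
   Context: An $r$-uniform hypergraph $H=(V(H),E(H))$ consists of a finite vertex set $V(H)$ and a set $E(H)$ of $r$-element subsets of $V(H)$, called hyperedges. A 2-hypermultiplex is a pair $\mathbf H_n=(H_n^{(1)},H_n^{(2)})$ of uniform hypergraphs with a common vertex set $V_n$. ''Colored uniformly at random with $c_n$ colors'' means each $v\in V_n$ gets a color $X_v$ uniform on $\{1,\dots,c_n\}$, independently over the vertices (a single coloring is used for both layers). $T(H_n^{(i)})=\sum_{e\in E(H_n^{(i)})}\mathbf 1\{X_v=X_{v'}\ \forall v,v'\in e\}$ is the number of monochromatic hyperedges of $H_n^{(i)}$, and $\mathbf T(\mathbf H_n)=(T(H_n^{(1)}),T(H_n^{(2)}))^\top$. $\mathrm{Var}$ of a random vector denotes its covariance matrix. $\mathrm{Pois}(0)$ is the point mass at $0$. *)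

(* Defs.v *)
From HB Require Import structures.
From mathcomp Require Export all_boot all_order all_algebra.
From mathcomp Require Export all_classical all_reals all_analysis.

Set Implicit Arguments.
Unset Strict Implicit.
Unset Printing Implicit Defensive.

Import Order.TTheory GRing.Theory Num.Theory.
Import numFieldNormedType.Exports.

Local Open Scope classical_set_scope.
Local Open Scope ring_scope.

Record uhypergraph (r : nat) (V : finType) := UHypergraph {
  hyperedges : {set {set V}};
  hyperedges_uniform : forall e : {set V}, e \in hyperedges -> #|e| = r }.

Record hypermultiplex2 (r1 r2 : nat) := Hypermultiplex2 {
  vertex : finType;
  layer1 : uhypergraph r1 vertex;
  layer2 : uhypergraph r2 vertex }.

Definition monochromatic (V : finType) (x : V -> nat) (e : {set V}) : bool :=
  [forall v in e, forall v' in e, x v == x v'].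

Definition num_mono_edges (r : nat) (V : finType) (H : uhypergraph r V)
    (x : V -> nat) : nat :=
  (\sum_(e in hyperedges H) monochromatic x e)%N.

Definition mutually_independent (d d' : measure_display)
    (W : measurableType d) (E : measurableType d') (R : realType)
    (P : probability W R) (I : finType) (X : I -> {RV P >-> E}) : Prop :=
  forall (J : {set I}) (B : I -> set E),
    (forall i, measurable (B i)) ->
    P (\bigcap_(i in [set` J]) (X i @^-1` B i)) =
    (\prod_(i in J) P (X i @^-1` B i))%E.

(* The colours are the naturals 1, ..., c. As the c values listed carry total
   mass 1, each X v takes values in {1, ..., c} almost surely. *)
Definition uniform_coloring (d : measure_display) (W : measurableType d)
    (R : realType) (P : probability W R) (V : finType) (c : nat)
    (X : V -> {RV P >-> nat}) : Prop :=
  [/\ (0 < c)%N,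
      forall (v : V) (k : nat), (1 <= k <= c)%N ->
        P (X v @^-1` [set k]) = (c%:R^-1)%:E
    & mutually_independent X].

Definition mono_edges (d : measure_display) (W : measurableType d)
    (R : realType) (P : probability W R) (r : nat) (V : finType)
    (H : uhypergraph r V) (X : V -> {RV P >-> nat}) : W -> R :=
  fun w => (num_mono_edges H (fun v => X v w))%:R.

(* The parameter rate is meant to be nonnegative; poisson_prob 0 is the Dirac
   mass at 0, and the last argument of poisson_prob is unused. *)
Definition is_poisson (d : measure_display) (W : measurableType d)
    (R : realType) (P : probability W R) (rate : R) (Z : {RV P >-> nat}) :
    Prop :=
  forall B : set nat, distribution P Z B = poisson_prob rate 0%N B.

(* Weak convergence of the laws, tested on bounded continuous functions; the
   random elements X n may live on different probability spaces. It is meant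
   for X n and Y measurable for the Borel sigma-algebra of E. *)
Definition cvg_in_distribution (R : realType) (E : topologicalType)
    (d : nat -> measure_display) (W : forall n, measurableType (d n))
    (P : forall n, probability (W n) R) (X : forall n, W n -> E)
    (d' : measure_display) (W' : measurableType d') (P' : probability W' R)
    (Y : W' -> E) : Prop :=
  forall f : E -> R, continuous f -> (exists M : R, forall x, `|f x| <= M) ->
    'E_(P n)[f \o X n]%E @[n --> \oo] --> 'E_P'[f \o Y]%E.

(* Main.v *)
Require Import Defs.
From HB Require Import structures.
From mathcomp Require Import all_boot all_order all_algebra.
From mathcomp Require Import all_classical all_reals all_analysis.
From mathcomp Require Import measurable_realfun zify ring lra.

Set Implicit Arguments.
Unset Strict Implicit.
Unset Printing Implicit Defensive.

Import Order.TTheory GRing.Theory Num.Theory.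
Import numFieldNormedType.Exports.

Local Open Scope ring_scope.

(** Write p = c^(1-r) for the probability that a given hyperedge is
    monochromatic. The joint law of the two counts is identified through the
    generating function E[a^T1 b^T2] with a, b in [0, 1]. It equals
    E[prod_e (1 - u_e 1_e)], where e runs over the union of the two edge sets,
    1_e says that e is monochromatic, and the weight u_e in [0, 1] depends only
    on the layers that contain e. It is therefore enough to show that this
    expectation is close to exp(- p sum_e u_e) and that the exponent converges.

    Uniformity of the colours does most of the work. If h is a vertex of e,
    then, given all colours outside e minus h, the edge e is monochromatic with
    probability exactly p (avg_mono_mul). Choosing for every edge such a vertex,
    its hub, and removing the factors of the product one edge at a time,
    replacing 1_e by p, costs at most the sum of P(1_e 1_f) + p^2 over the edges
    f that meet e outside its hub (avg_prod1B). Independence up to a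
    neighbourhood thus replaces every computation of higher moments.

    These costs vanish for two reasons. Pairs of distinct edges with at least
    two common vertices are positively correlated, whereas pairs with at most
    one common vertex are independent; so the covariance of two counts is
    p - p^2 times the number of common edges plus a term between one half and
    the whole of the total probability of the overlapping pairs (covar_split).
    Since mean and variance have the same limit in each layer, the overlapping
    pairs inside a layer are negligible. Overlapping pairs across the layers are
    then negligible as well, by Cauchy-Schwarz on codegrees (overlapU), which
    identifies l12 as the limit of p times the number of common edges. Pairs
    with exactly one common vertex, off the hub, are few if the hub is a vertex
    of largest degree: a vertex v of e and the hub w of e satisfy
    deg v <= sqrt (deg v * deg w), and Cauchy-Schwarz bounds the sum of these
    quantities by the square root of the sum of squared codegrees, which is
    o(1/p), times the sum of all degrees, of order 1/p (off_hub_degree,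
    near_sum_le).

    Generating functions converging on [0, 1]^2 give convergence of all point
    probabilities, by letting a and b tend to 0, and this implies convergence
    of the expectations of all bounded functions (cvg_mean_of_pgf), because no
    mass escapes: the limit is a probability. *)

(** * Uniform colourings of a finite set *)

Section Colorings.
Import mathcomp.boot.finset.
Variables (R : realType) (V : finType) (c : nat).
Hypothesis c_gt0 : (0 < c)%N.
Implicit Types (x : {ffun V -> 'I_c}) (e f A : {set V}).
Implicit Types (F G g : {ffun V -> 'I_c} -> R).

Definition avg g : R := (\sum_x g x) / (c ^ #|V|)%:R.

Lemma eq_avg F G : F =1 G -> avg F = avg G.
Proof. by move=> FG; rewrite /avg; congr (_ / _); apply: eq_bigr. Qed.

Lemma avgD F G : avg (fun x => F x + G x) = avg F + avg G.
Proof. by rewrite /avg big_split mulrDl. Qed.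

Lemma avgZ k F : avg (fun x => k * F x) = k * avg F.
Proof. by rewrite /avg -mulr_sumr mulrA. Qed.

Lemma avgB F G : avg (fun x => F x - G x) = avg F - avg G.
Proof.
rewrite -[- avg G]mulN1r -avgZ -avgD.
by apply: eq_avg => x; rewrite mulN1r.
Qed.

Lemma avg_sum (I : Type) (s : seq I) (Q : pred I) (F : I -> _ -> R) :
  avg (fun x => \sum_(i <- s | Q i) F i x) = \sum_(i <- s | Q i) avg (F i).
Proof. by rewrite /avg exchange_big /= mulr_suml. Qed.

Lemma avg_cst k : avg (fun=> k) = k.
Proof.
rewrite /avg sumr_const card_ffun card_ord -[k *+ _]mulr_natr mulfK //.
by rewrite pnatr_eq0 -lt0n expn_gt0 c_gt0.
Qed.

Lemma ler_avg F G : (forall x, F x <= G x) -> avg F <= avg G.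
Proof.
by move=> FG; rewrite /avg ler_wpM2r ?invr_ge0 ?ler0n //; apply: ler_sum.
Qed.

Lemma ler_norm_avg F : `|avg F| <= avg (fun x => `|F x|).
Proof.
rewrite /avg normrM [X in _ * X <= _]ger0_norm ?invr_ge0 ?ler0n //.
by rewrite ler_wpM2r ?invr_ge0 ?ler0n // ler_norm_sum.
Qed.

Definition recolor x (a : V) (k : 'I_c) : {ffun V -> 'I_c} :=
  [ffun v => if v == a then k else x v].

Definition ignores (T : Type) (A : {set V}) (g : {ffun V -> 'I_c} -> T) :=
  forall x a k, a \in A -> g (recolor x a k) = g x.

(** Resampling the colour of one vertex preserves the uniform law: the map
    (x, k) |-> (recolor x a k, x a) is an involution. *)
Lemma avg_recolor F a :
  c%:R * avg F = avg (fun x => \sum_k F (recolor x a k)).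
Proof.
rewrite /avg mulrA; congr (_ / _).
pose sw (q : {ffun V -> 'I_c} * 'I_c) := (recolor q.1 a q.2, q.1 a).
have swK : involutive sw.
  move=> [x k]; rewrite /sw /=; congr pair; last by rewrite ffunE eqxx.
  by apply/ffunP => v; rewrite !ffunE; case: eqP => [->|].
rewrite pair_big /= (reindex_inj (inv_inj swK)) /=.
transitivity (\sum_x \sum_(k < c) F x).
  by rewrite mulr_sumr; apply: eq_bigr => x _; rewrite sumr_const card_ord mulr_natl.
rewrite pair_big /=; apply: eq_bigr => -[x k] _ /=; congr F.
by have [] := swK (x, k).
Qed.

Lemma avg_agree1 a h g : a != h -> ignores [set a] g ->
  avg (fun x => (x a == x h)%:R * g x) = c%:R^-1 * avg g.
Proof.
move=> ah ig.
have c0 : c%:R != 0 :> R by rewrite pnatr_eq0 -lt0n.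
apply: (mulfI c0); rewrite mulVKf // (avg_recolor _ a); apply: eq_avg => x.
rewrite (bigD1 (x h)) //= big1 => [|k kh].
  by rewrite !ffunE eqxx [h == a]eq_sym (negPf ah) eqxx mul1r addr0 ig ?inE.
by rewrite !ffunE eqxx [h == a]eq_sym (negPf ah) (negPf kh) mul0r.
Qed.

(** The vertices of A are resampled one at a time; each one takes the colour of h
    with probability 1/c, whatever the other colours are. *)
Lemma avg_agree A h g : h \notin A -> ignores A g ->
  avg (fun x => [forall v in A, x v == x h]%:R * g x)
  = (c ^ #|A|)%:R^-1 * avg g.
Proof.
move: {2}#|A| (erefl #|A|) => n; elim: n A => [|n IH] A An hA ig.
  have A0 : A = set0 by apply/eqP; rewrite -cards_eq0 An.
  rewrite An expn0 invr1 mul1r; apply: eq_avg => x.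
  suff -> : [forall v in A, x v == x h] by rewrite mul1r.
  by apply/forall_inP => v; rewrite A0 inE.
have [a aA] : exists a, a \in A by apply/card_gt0P; rewrite An.
have ah : a != h by apply: contraNneq hA => <-.
have hA' : h \notin A :\ a by rewrite inE (negPf hA) andbF.
have An' : #|A :\ a| = n by move: An; rewrite (cardsD1 a) aA => -[].
rewrite An expnS natrM invfM -mulrA -An' -(IH _ An' hA'); last first.
  by move=> x b k; rewrite inE => /andP[_ /ig].
rewrite -(avg_agree1 ah).
  apply: eq_avg => x; rewrite mulrA -natrM mulnb; congr ((_ : bool)%:R * _).
  apply/forall_inP/andP => [xA|[xa /forall_inP xA] v vA].
    by split; [exact: xA | apply/forall_inP => v; rewrite inE => /andP[_ /xA]].
  by have [->//|va] := eqVneq v a; apply: xA; rewrite !inE va.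
move=> x b k /set1P ->; rewrite ig //; congr ((_ : bool)%:R * _).
apply: eq_forallb_in => v; rewrite !inE => /andP[va _].
by rewrite !ffunE (negPf va) [h == a]eq_sym (negPf ah).
Qed.

(** The colours 'I_c are shifted to 1, ..., c. *)
Definition palette x : V -> nat := fun v => (x v).+1.
Local Notation mono x e := (monochromatic (palette x) e).

Lemma mono_agree x e h : h \in e ->
  mono x e = [forall v in e :\ h, x v == x h].
Proof.
move=> he; apply/forall_inP/forall_inP => [xe v|xe v ve].
  by rewrite !inE => /andP[_ /xe /forall_inP/(_ _ he)].
have xh u : u \in e -> x u = x h.
  by move=> ue; have [->//|uh] := eqVneq u h; apply/eqP/xe; rewrite !inE uh.
by apply/forall_inP => u ue; rewrite /palette !xh.
Qed.

Lemma mono_ignores e A : [disjoint A & e] -> ignores A (fun x => mono x e).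
Proof.
move=> Ae x a k aA; have re v : v \in e -> palette (recolor x a k) v = palette x v.
  move=> ve; rewrite /palette ffunE; case: eqP ve => // -> ae.
  by rewrite (disjointFr Ae aA) in ae.
by apply: eq_forallb_in => v ve; apply: eq_forallb_in => u ue; rewrite !re.
Qed.

(** Given all colours outside e minus h, the edge e is monochromatic with a
    probability that does not depend on these colours. The colour of h is among
    them, so g may depend on it: e is independent of all events that it meets
    only in h. *)
Lemma avg_mono_mul e h g : h \in e -> ignores (e :\ h) g ->
  avg (fun x => (mono x e)%:R * g x) = (c ^ #|e|.-1)%:R^-1 * avg g.
Proof.
move=> he ig; have -> : #|e|.-1 = #|e :\ h| by rewrite (cardsD1 h) he.
rewrite -(avg_agree (h := h)) ?inE ?eqxx //; apply: eq_avg => x.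
by rewrite (mono_agree _ he).
Qed.

Definition both e f := avg (fun x => (mono x e)%:R * (mono x f)%:R).

Lemma both_ge0 e f : 0 <= both e f.
Proof. by rewrite -(avg_cst 0); apply: ler_avg => x; rewrite mulr_ge0. Qed.

Lemma avg_mono e : e != set0 ->
  avg (fun x => (mono x e)%:R) = (c ^ #|e|.-1)%:R^-1.
Proof.
case/set0Pn => h he; have := @avg_mono_mul e h (fun=> 1) he (fun _ _ _ _ => erefl).
by rewrite avg_cst mulr1 => <-; apply: eq_avg => x; rewrite mulr1.
Qed.

(** If h is the common vertex, or any vertex of e when the edges are disjoint,
    then f avoids e minus h. *)
Lemma both_indep e f : e != set0 -> f != set0 -> (#|e :&: f| <= 1)%N ->
  both e f = (c ^ #|e|.-1)%:R^-1 * (c ^ #|f|.-1)%:R^-1.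
Proof.
move=> e0 f0 ef; rewrite -(avg_mono f0).
have [h he hf] : exists2 h, h \in e & [disjoint e :\ h & f].
  have [ef0|/set0Pn[h]] := eqVneq (e :&: f) set0.
    have /set0Pn[h he] := e0; exists h => //.
    by rewrite -setI_eq0 setIDAC ef0 set0D.
  rewrite inE => /andP[he hf]; exists h => //.
  have : e :&: f == [set h].
    by rewrite eq_sym eqEcard cards1 ef sub1set inE he hf.
  by move/eqP => efh; rewrite -setI_eq0 setIDAC efh setDv.
apply: (avg_mono_mul he) => x a k ae; congr (_%:R).
by rewrite (mono_ignores hf).
Qed.

Lemma both_meet e f : e :&: f != set0 ->
  both e f = (c ^ #|e :|: f|.-1)%:R^-1.
Proof.
case/set0Pn => h /setIP[he hf]; rewrite -avg_mono; last first.
  by apply/set0Pn; exists h; rewrite inE he.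
apply: eq_avg => x; rewrite -natrM mulnb; congr ((_ : bool)%:R).
rewrite !(@mono_agree x _ h) ?inE ?he //.
apply/andP/forall_inP => [[/forall_inP xe /forall_inP xf] v|xe].
  by rewrite !inE => /andP[vh /orP[ve|vf]]; [apply: xe | apply: xf]; rewrite !inE vh.
by split; apply/forall_inP => v /setD1P[vh vef]; apply: xe; rewrite !inE vh vef ?orbT.
Qed.

End Colorings.
Notation mono x e := (monochromatic (palette x) e).

(** * Products of weakly dependent indicators *)

Lemma expRN_le_quad (R : realType) (y : R) : 0 <= y -> expR (- y) <= 1 - y + y ^+ 2.
Proof.
move=> y0; have y1 : 0 < 1 + y by lra.
have e1 : 1 + y <= expR y := expR_ge1Dx y.
rewrite expRN; apply: (@le_trans _ _ (1 + y)^-1).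
  by rewrite lef_pV2 ?posrE // (lt_le_trans y1).
rewrite -[X in X <= _]mul1r ler_pdivrMr //.
have y2 := mulr_ge0 y0 (sqr_ge0 y); nra.
Qed.

Lemma prod1B_bounds (R : realType) (I : Type) (s : seq I) (y : I -> R) :
  (forall i, 0 <= y i <= 1) -> 0 <= \prod_(i <- s) (1 - y i) <= 1.
Proof.
move=> y01; apply/andP; split.
  by apply: prodr_ge0 => i _; rewrite subr_ge0; case/andP: (y01 i).
by apply: prodr_ile1 => i _; have := y01 i; lra.
Qed.

(** A union bound over the omitted factors. *)
Lemma prod1B_drop (R : realType) (I : Type) (s : seq I) (Q : pred I) (y : I -> R) :
  (forall i, 0 <= y i <= 1) ->
  `|\prod_(i <- s) (1 - y i) - \prod_(i <- s | Q i) (1 - y i)|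
    <= \sum_(i <- s | ~~ Q i) y i.
Proof.
move=> y01; elim: s => [|i s IH]; first by rewrite !big_nil subrr normr0.
rewrite !big_cons; have /andP[yi0 yi1] := y01 i.
have /andP[p0 p1] := prod1B_bounds s y01.
case: (Q i) => /=.
  rewrite -mulrBr normrM ger0_norm ?subr_ge0 // (le_trans _ IH) //.
  by rewrite ler_piMl // gerBl.
rewrite mulrBl mul1r addrAC (le_trans (ler_normB _ _)) // [leLHS]addrC lerD //.
by rewrite ger0_norm ?mulr_ge0 // ler_piMr.
Qed.

Section ProductApproximation.
Import mathcomp.boot.finset.
Variables (R : realType) (V : finType) (c r : nat).
Hypothesis c_gt0 : (0 < c)%N.
Variables (u : {set V} -> R) (h : {set V} -> V).
Hypothesis u01 : forall e, 0 <= u e <= 1.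
Local Notation p := ((c ^ r.-1)%:R^-1 : R).
Local Notation both := (both R c).
Local Notation avg := (@avg R V c).
Implicit Types (x : {ffun V -> 'I_c}) (e f : {set V}) (s : seq {set V}).

(** The edges whose removal makes the remaining product independent of e. An edge
    that meets e only in its hub h e is not counted, although the two edges share
    a vertex. *)
Definition near_edge e f := (e :\ h e) :&: f != set0.

(** The factors are removed one edge at a time. In E[1_e F], with F the product over
    the remaining edges, dropping the factors of the edges near e gives a product
    F' that is independent of e, so that E[1_e F'] = p E[F']; restoring these
    factors in E[F'] gives p E[F]. The first change costs at most the sum of
    P(1_e 1_f), the second the sum of p^2, over the near edges f. The remaining
    p^2 is the error in 1 - u p = exp (- u p). *)
Lemma avg_prod1B s : uniq s -> (forall e, e \in s -> #|e| = r /\ h e \in e) ->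
  `|avg (fun x => \prod_(e <- s) (1 - u e * (mono x e)%:R))
    - expR (- \sum_(e <- s) u e * p)|
  <= \sum_(e <- s) (p ^+ 2 +
       \sum_(f <- s | (f != e) && near_edge e f) (both e f + p ^+ 2)).
Proof.
have p01 : 0 < p <= 1.
  by rewrite invr_gt0 ltr0n expn_gt0 c_gt0 invf_le1 ?ltr0n ?expn_gt0 ?c_gt0 // ler1n expn_gt0 c_gt0.
have bge0 e f : 0 <= both e f := both_ge0 R c_gt0 e f.
elim: s => [|e s IH] /=.
  by move=> _ _; rewrite !big_nil oppr0 expR0 (eq_avg (G := fun=> 1)) ?avg_cst ?subrr ?normr0 // => x; rewrite big_nil.
case/andP => es us sr.
have [er he] := sr _ (mem_head _ _).
have srs f : f \in s -> #|f| = r /\ h f \in f.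
  by move=> fs; apply: sr; rewrite inE fs orbT.
have {}IH := IH us srs.
pose F x := \prod_(f <- s) (1 - u f * (mono x f)%:R) : R.
pose F' x := \prod_(f <- s | ~~ near_edge e f) (1 - u f * (mono x f)%:R) : R.
pose eps := \sum_(f <- s | near_edge e f) (both e f + p ^+ 2).
have y01 x f : 0 <= u f * (mono x f)%:R <= 1.
  by case: (monochromatic _ _) => /=; rewrite ?mulr1 ?mulr0 ?lexx ?ler01.
have F01 x : 0 <= F x <= 1 by apply: prod1B_bounds => f; apply: y01.
have FF' x : `|F x - F' x| <= \sum_(f <- s | near_edge e f) (mono x f)%:R.
  apply: (le_trans (prod1B_drop _ _ (y01 x))).
  under eq_bigl do rewrite negbK; apply: ler_sum => f _.
  by rewrite ler_piMl //; case/andP: (u01 f).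
have F'ind : avg (fun x => (mono x e)%:R * F' x) = p * avg F'.
  rewrite (avg_mono_mul c_gt0 he) ?er // => x a k ae.
  rewrite /F'; apply: eq_bigr => f; rewrite /near_edge negbK setI_eq0 => ef.
  by rewrite (mono_ignores ef).
have near_mono f : f \in s -> avg (fun x => (mono x f)%:R) = p.
  move=> fs; have [fr hf] := srs f fs.
  by rewrite avg_mono ?fr //; apply/set0Pn; exists (h f).
have err1 : `|avg (fun x => (mono x e)%:R * F x) - p * avg F| <= eps.
  have -> : avg (fun x => (mono x e)%:R * F x) - p * avg F =
     avg (fun x => (mono x e)%:R * (F x - F' x)) - p * avg (fun x => F x - F' x).
    have -> : avg (fun x => (mono x e)%:R * (F x - F' x)) =
        avg (fun x => (mono x e)%:R * F x) - avg (fun x => (mono x e)%:R * F' x).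
      by rewrite -avgB; apply: eq_avg => x; rewrite mulrBr.
    by rewrite avgB F'ind; ring.
  rewrite (le_trans (ler_normB _ _)) // /eps big_split /= lerD //.
    rewrite (le_trans (ler_norm_avg _)) //.
    rewrite -avg_sum; apply: ler_avg => x; rewrite -mulr_sumr.
    by rewrite normrM ger0_norm // ler_wpM2l.
  have /andP[/ltW p0 _] := p01.
  rewrite normrM ger0_norm // expr2 -mulr_sumr ler_wpM2l //.
  rewrite (le_trans (ler_norm_avg _)) // (le_trans (ler_avg FF')) //.
  rewrite avg_sum big_seq_cond [leRHS]big_seq_cond ler_sum // => f /andP[fs _].
  by rewrite near_mono.
rewrite big_cons (eq_avg (G := fun x => F x - u e * ((mono x e)%:R * F x))); last first.
  by move=> x; rewrite big_cons mulrBl mul1r mulrA.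
rewrite avgB avgZ big_cons opprD expRD.
set g := expR (- \sum_(f <- s) _) in IH *.
have g01 : 0 <= g <= 1.
  rewrite expR_ge0 -expR0 ler_expR oppr_le0 sumr_ge0 // => f _.
  by apply: mulr_ge0; [case/andP: (u01 f) | rewrite invr_ge0].
set A := avg (fun x => _ * F x) in err1 *.
have up01 : 0 <= u e * p <= 1.
  have /andP[/ltW p0 p1] := p01; have /andP[u0 u1] := u01 e.
  by rewrite mulr_ge0 //= mulr_ile1.
have /andP[g0 g1] := g01; have /andP[u0 u1] := u01 e.
have /andP[up0 up1] := up01; have /andP[p0 p1] := p01.
have q1 := expR_ge1Dx (- (u e * p)).
have q2 := expRN_le_quad up0.
have -> : avg F - u e * A - expR (- (u e * p)) * g =
  (1 - u e * p) * (avg F - g) - (expR (- (u e * p)) - (1 - u e * p)) * g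
  - u e * (A - p * avg F) by ring.
(* the edge e itself contributes no near pair, and it does not occur in s *)
have sE : \sum_(f <- s | (f != e) && near_edge e f) (both e f + p ^+ 2) = eps.
  rewrite /eps big_seq_cond [RHS]big_seq_cond; apply: eq_bigl => f.
  by case fs: (f \in s) => //=; case: eqP fs => // ->; rewrite (negPf es).
rewrite big_cons eqxx /= sE.
have t1 : `|(1 - u e * p) * (avg F - g)| <= `|avg F - g|.
  by rewrite normrM ger0_norm ?subr_ge0 // ler_piMl // gerBl.
have t2 : `|(expR (- (u e * p)) - (1 - u e * p)) * g| <= p ^+ 2.
  have upp : (u e * p) ^+ 2 <= p ^+ 2.
    by rewrite ler_pXn2r ?nnegrE ?up0 ?ler_piMl // ltW.
  rewrite normrM (ger0_norm g0) ger0_norm; last by lra.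
  by apply: le_trans (ler_piMr _ g1) _; lra.
have t3 : `|u e * (A - p * avg F)| <= eps.
  by rewrite normrM ger0_norm // (le_trans _ err1) // ler_piMl.
have {}IH : `|avg F - g| <= \sum_(f <- s) (p ^+ 2 +
    \sum_(f0 <- e :: s | (f0 != f) && near_edge f f0) (both f f0 + p ^+ 2)).
  apply: (le_trans IH); rewrite ler_sum // => f _; rewrite lerD2l big_cons.
  by case: ifP => // _; rewrite lerDr addr_ge0 // sqr_ge0.
apply: (le_trans (ler_normB _ _)); rewrite [leRHS]addrC addrA lerD //.
by apply: (le_trans (ler_normB _ _)); rewrite lerD // (le_trans t1 IH).
Qed.

End ProductApproximation.

(** * Pairs of edges with several common vertices *)

Section Overlaps.
Import mathcomp.boot.finset.
Variables (R : realType) (V : finType) (c r : nat).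
Hypotheses (c_gt1 : (1 < c)%N) (r_gt1 : (1 < r)%N).
Local Notation p := ((c ^ r.-1)%:R^-1 : R).
Local Notation both := (both R c).
Local Notation avg := (@avg R V c).
Implicit Types (x : {ffun V -> 'I_c}) (e f B : {set V}) (A E : {set {set V}}).

Let c_gt0 : (0 < c)%N := ltnW c_gt1.

Lemma p_gt0 : 0 < p.
Proof. by rewrite invr_gt0 ltr0n expn_gt0 c_gt0. Qed.

Definition uniform_edges A := forall e, e \in A -> #|e| = r.

Lemma edge_neq0 e : #|e| = r -> e != set0.
Proof. by move=> er; rewrite -card_gt0 er ltnW. Qed.

(** The probability that two edges with t >= 1 common vertices are both
    monochromatic: their union has 2 r - t vertices. *)
Definition shared_weight (t : nat) : R := (c ^ (r.*2.-1 - t))%:R^-1.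

Lemma shared_weight_ge0 t : 0 <= shared_weight t.
Proof. by rewrite invr_ge0. Qed.

Lemma shared_weight_le t t' : (t <= t')%N -> shared_weight t <= shared_weight t'.
Proof.
move=> tt'; rewrite /shared_weight lef_pV2 ?posrE ?ltr0n ?expn_gt0 ?c_gt0 //.
by rewrite ler_nat leq_pexp2l // leq_sub2l.
Qed.

Lemma both_shared e f : #|e| = r -> #|f| = r -> (1 < #|e :&: f|)%N ->
  both e f = shared_weight #|e :&: f|.
Proof.
move=> er fr ef; rewrite both_meet //; last by rewrite -card_gt0 ltnW.
congr ((c ^ _)%:R^-1); have := cardsUI e f; rewrite er fr -addnn.
have := subset_leq_card (subsetUl e f); rewrite er; lia.
Qed.

(** The quotient of P(1_e 1_f) by p^2 is c^(t-1), with t >= 2 common vertices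
    and c >= 2. *)
Lemma both_gt_indep e f : #|e| = r -> #|f| = r -> (1 < #|e :&: f|)%N ->
  2 * p ^+ 2 <= both e f.
Proof.
move=> er fr ef; rewrite both_shared //; have c0 : (0 : R) < c%:R by rewrite ltr0n.
apply: (@le_trans _ _ (shared_weight 2)); last exact: shared_weight_le.
have -> : shared_weight 2 = c%:R * p ^+ 2.
  rewrite exprVn -natrX -expnM /shared_weight.
  have -> : (r.-1 * 2)%N = (r.*2.-1 - 2).+1 by lia.
  by rewrite expnS natrM invfM mulVKf // gt_eqF.
by rewrite ler_wpM2r ?sqr_ge0 // ler_nat.
Qed.

Lemma both_refl e : #|e| = r -> both e e = p.
Proof. by move=> er; rewrite both_meet ?setIid ?edge_neq0 // setUid er. Qed.

Lemma both_far e f : #|e| = r -> #|f| = r -> (#|e :&: f| <= 1)%N ->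
  both e f = p ^+ 2.
Proof. by move=> er fr ef; rewrite both_indep ?edge_neq0 // er fr expr2. Qed.

Definition overlap A E : R :=
  \sum_(e in A) \sum_(f in E | (f != e) && (1 < #|e :&: f|)%N) both e f.

Lemma overlap_ge0 A E : 0 <= overlap A E.
Proof. by apply: sumr_ge0 => e _; apply: sumr_ge0 => f _; apply: both_ge0. Qed.

Definition count_mono A x : R := \sum_(e in A) (mono x e)%:R.

Lemma avg_count_mono A : uniform_edges A -> avg (count_mono A) = #|A|%:R * p.
Proof.
move=> Ar; rewrite /count_mono avg_sum mulr_natl -sumr_const.
by apply: eq_bigr => e /Ar er; rewrite avg_mono ?edge_neq0 // er.
Qed.

Definition covar A E : R :=
  avg (fun x => (count_mono A x - avg (count_mono A)) *
                (count_mono E x - avg (count_mono E))).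

Lemma covarE A E : uniform_edges A -> uniform_edges E ->
  covar A E = \sum_(e in A) \sum_(f in E) (both e f - p ^+ 2).
Proof.
move=> Ar Er; rewrite /covar !avg_count_mono //.
transitivity (avg (fun x => \sum_(e in A) \sum_(f in E)
   ((mono x e)%:R - p) * ((mono x f)%:R - p))).
  apply: eq_avg => x; rewrite /count_mono !mulr_natl -!sumr_const -!sumrB mulr_suml.
  by apply: eq_bigr => e _; rewrite mulr_sumr.
rewrite avg_sum; apply: eq_bigr => e eA; rewrite avg_sum; apply: eq_bigr => f fE.
rewrite (eq_avg (G := fun x => (mono x e)%:R * (mono x f)%:R
  + ((- p) * (mono x e)%:R + ((- p) * (mono x f)%:R + p ^+ 2)))); last first.
  by move=> x; ring.
rewrite !avgD !avgZ avg_cst // !avg_mono ?edge_neq0 ?(Ar e) ?(Er f) //.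
by rewrite -/(both e f); ring.
Qed.

(** Pairs of edges with at most one common vertex are uncorrelated. For two or more
    common vertices the covariance P(1_e 1_f) - p^2 lies between P(1_e 1_f) / 2 and
    P(1_e 1_f). So a variance close to the mean leaves no room for overlaps. *)
Lemma covar_split A E : uniform_edges A -> uniform_edges E ->
  #|A :&: E|%:R * (p - p ^+ 2) + overlap A E / 2 <= covar A E
    <= #|A :&: E|%:R * (p - p ^+ 2) + overlap A E.
Proof.
move=> Ar Er; rewrite covarE //.
have -> : \sum_(e in A) \sum_(f in E) (both e f - p ^+ 2) =
   #|A :&: E|%:R * (p - p ^+ 2) +
   \sum_(e in A) \sum_(f in E | (f != e) && (1 < #|e :&: f|)%N) (both e f - p ^+ 2).
  have -> : #|A :&: E|%:R * (p - p ^+ 2) = \sum_(e in A) \sum_(f in E | f == e) (p - p ^+ 2).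
    rewrite mulr_natl -sumr_const.
    rewrite (eq_bigl (fun e => (e \in A) && (e \in E))); last by move=> e; rewrite inE.
    rewrite big_mkcondr; apply: eq_bigr => e _.
    case: ifP => eE; last first.
      by rewrite big1 // => f /andP[fE /eqP fe]; rewrite fe eE in fE.
    rewrite (big_pred1 e) // => f /=; rewrite andbC; case: eqP => // ->.
    by rewrite eE.
  rewrite -big_split /=; apply: eq_bigr => e eA.
  rewrite (bigID (fun f => f == e)) /=; congr (_ + _).
    apply: eq_bigr => f /andP[fE /eqP ->]; rewrite both_refl ?Ar //.
  rewrite (bigID (fun f => (1 < #|e :&: f|)%N)) /= [X in _ + X]big1 ?addr0.
    by apply: eq_bigl => f; rewrite andbA.
  move=> f /andP[/andP[fE _]]; rewrite -leqNgt => ef.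
  by rewrite both_far ?subrr ?(Ar _ eA) ?(Er _ fE).
rewrite !lerD2l /overlap; apply/andP; split.
  rewrite mulr_suml; apply: ler_sum => e eA.
  rewrite mulr_suml; apply: ler_sum => f /andP[fE /andP[_ ef]].
  by have := both_gt_indep (Ar _ eA) (Er _ fE) ef; lra.
apply: ler_sum => e eA; apply: ler_sum => f _.
by rewrite gerBl sqr_ge0.
Qed.

Definition codegree A B : R := \sum_(e in A) (B \subset e)%:R.

(** A quadratic form in the codegrees that is comparable to the overlap within one
    layer. Being quadratic, it controls the union of two layers as well, which
    the two overlaps do not show directly. *)
Definition codegree_energy A : R :=
  \sum_(B : {set V} | (1 < #|B| < r)%N) shared_weight #|B| * codegree A B ^+ 2.

Lemma codegree_energyE A : codegree_energy A = \sum_(e in A) \sum_(f in A)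
  \sum_(B : {set V} | (1 < #|B| < r)%N && (B \subset e :&: f)) shared_weight #|B|.
Proof.
rewrite /codegree_energy.
under [RHS]eq_bigr => e _.
  under eq_bigr => f _ do rewrite big_mkcondr.
  rewrite exchange_big /=; over.
rewrite exchange_big /=; apply: eq_bigr => B _.
rewrite expr2 /codegree mulr_suml mulr_sumr; apply: eq_bigr => e _.
rewrite !mulr_sumr; apply: eq_bigr => f _.
by rewrite subsetI; do 2!case: (_ \subset _); rewrite ?mulr1 ?mulr0 ?mul0r ?mulr0.
Qed.

(** The pair (e, f) is counted at B = e :&: f. *)
Lemma overlap_le_energy E : uniform_edges E -> overlap E E <= codegree_energy E.
Proof.
move=> Er; rewrite codegree_energyE; apply: ler_sum => e eE.
rewrite big_mkcondr; apply: ler_sum => f fE; case: ifP => [/andP[fe ef]|_]; last first.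
  by apply: sumr_ge0 => B _; apply: shared_weight_ge0.
rewrite (both_shared (Er _ eE) (Er _ fE) ef) (bigD1 (e :&: f)) /=.
  by rewrite lerDl; apply: sumr_ge0 => B _; apply: shared_weight_ge0.
rewrite ef subxx andbT /= -[ltnRHS](Er _ eE) proper_card // properEneq subsetIl andbT.
apply: contraNneq fe => /setIidPl ef'; rewrite eq_sym eqEcard ef'.
by rewrite (Er _ eE) (Er _ fE) leqnn.
Qed.

(** A pair e <> f is counted for at most 2^r sets B, each time with a weight of at most
    P(1_e 1_f). The pairs e = f are only counted for |B| < r, with a weight of at
    most p / c: this is why full edges are excluded from the energy. *)
Lemma energy_le_overlap A : uniform_edges A ->
  codegree_energy A <= (2 ^ r)%:R * (overlap A A + #|A|%:R * p / c%:R).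
Proof.
move=> Ar; rewrite codegree_energyE /overlap -mulrA [#|A|%:R * _]mulr_natl -sumr_const.
rewrite -big_split /= mulr_sumr; apply: ler_sum => e eA.
have sub_le f (w : R) : 0 <= w ->
    (forall B, (1 < #|B| < r)%N && (B \subset e :&: f) -> shared_weight #|B| <= w) ->
    \sum_(B : {set V} | (1 < #|B| < r)%N && (B \subset e :&: f)) shared_weight #|B|
      <= (2 ^ r)%:R * w.
  move=> w0 wB; apply: (le_trans (ler_sum _ wB)).
  rewrite sumr_const -[w *+ _]mulr_natl ler_wpM2r // ler_nat -[X in (_ ^ X)%N](Ar _ eA).
  rewrite -card_powerset; apply/subset_leq_card/fintype.subsetP => B.
  by rewrite powersetE => /andP[_]; rewrite subsetI => /andP[].
rewrite (bigD1 e) //= addrC mulrDr lerD //; last first.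
  apply: sub_le => [|B /andP[/andP[_ Br] _]].
    by rewrite divr_ge0 // ltW // p_gt0.
  have -> : p / c%:R = shared_weight r.-1.
    rewrite -invfM -natrM -expnSr /shared_weight; congr ((c ^ _)%:R^-1).
    by move: r_gt1; clear; lia.
  by apply: shared_weight_le; move: Br; clear; lia.
rewrite mulr_sumr big_mkcondr [leRHS]big_mkcondr; apply: ler_sum => f fA.
case: (f =P e) => //= fe; case: ifPn => [ef|nef].
  by apply: sub_le => [|B /andP[_ Bef]]; [exact: both_ge0 |
    rewrite (both_shared (Ar _ eA) (Ar _ fA) ef) shared_weight_le // subset_leq_card].
rewrite big_pred0 // => B; apply/negbTE; apply: contra nef.
by move=> /andP[/andP[B1 _] /subset_leq_card]; apply: leq_trans.
Qed.

Lemma energyU A E : codegree_energy (A :|: E) <=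
  2 * (codegree_energy A + codegree_energy E).
Proof.
rewrite /codegree_energy -big_split /= mulr_sumr; apply: ler_sum => B _.
rewrite -mulrDr [leRHS]mulrCA ler_wpM2l ?shared_weight_ge0 //.
have d0 A' : 0 <= codegree A' B by apply: sumr_ge0.
have dU : codegree (A :|: E) B <= codegree A B + codegree E B.
  rewrite /codegree [leLHS]big_mkcond [X in X + _]big_mkcond [X in _ + X]big_mkcond -big_split /=; apply: ler_sum => e _; rewrite inE.
  by do 3!case: (_ \in _) || case: (_ \subset _); rewrite /= ?addr0 ?add0r ?lerDl.
apply: (@le_trans _ _ ((codegree A B + codegree E B) ^+ 2)).
  by rewrite lerXn2r ?nnegrE ?addr_ge0.
have := sqr_ge0 (codegree A B - codegree E B).
by rewrite sqrrB sqrrD; lra.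
Qed.

(** Overlaps between two layers are small when the overlaps inside the layers are. *)
Lemma overlapU A E : uniform_edges A -> uniform_edges E ->
  overlap (A :|: E) (A :|: E) <=
  (2 ^ r.+1)%:R * (overlap A A + overlap E E + (#|A|%:R + #|E|%:R) * p / c%:R).
Proof.
move=> Ar Er; have AEr : uniform_edges (A :|: E).
  by move=> e /setUP[/Ar|/Er].
apply: (le_trans (overlap_le_energy AEr)); apply: (le_trans (energyU _ _)).
have := energy_le_overlap Ar; have := energy_le_overlap Er.
rewrite expnS natrM; move: (2 ^ r)%:R => k; lra.
Qed.

Lemma overlap_cross A E (D : {set {set V}}) : A \subset D -> E \subset D -> overlap A E <= overlap D D.
Proof.
move=> AD ED; rewrite /overlap big_mkcond [leRHS]big_mkcond; apply: ler_sum => e _.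
case: ifP => [eA|_]; last by case: ifP => // _; apply: sumr_ge0 => f _; apply: both_ge0.
rewrite (fintype.subsetP AD _ eA) big_mkcondr [leRHS]big_mkcondr big_mkcond [leRHS]big_mkcond.
apply: ler_sum => f _; case: ifP => [fE|_]; first by rewrite (fintype.subsetP ED _ fE).
by case: ifP => // _; case: ifP => // _; apply: both_ge0.
Qed.

End Overlaps.

(** * Edges meeting away from the vertex of largest degree *)

Section Hubs.
Import mathcomp.boot.finset.
Variables (R : realType) (V : finType) (c r : nat).
Hypotheses (c_gt1 : (1 < c)%N) (r_gt1 : (1 < r)%N).
Variable E : {set {set V}}.
Hypothesis Er : uniform_edges r E.
Local Notation p := ((c ^ r.-1)%:R^-1 : R).
Local Notation both := (both R c).
Local Notation avg := (@avg R V c).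
Local Notation S := (overlap R c E E).
Local Notation N := (#|E|%:R : R).
Implicit Types (x : {ffun V -> 'I_c}) (e f : {set V}).

Let c_gt0 : (0 < c)%N := ltnW c_gt1.

Definition degree v : R := \sum_(f in E) (v \in f)%:R.

Lemma exists_hub : E != set0 ->
  exists h : {set V} -> V,
    forall e, e \in E -> h e \in e /\ forall v, v \in e -> degree v <= degree (h e).
Proof.
case/set0Pn => e0 e0E.
have [v0 _] : exists v0, v0 \in e0.
  by apply/set0Pn/(edge_neq0 r_gt1); apply: Er.
pose Q e v := e \in E -> v \in e /\ forall w, w \in e -> degree w <= degree v.
suff /boolp.choice[h hP] : forall e, exists v, Q e v by exists h.
move=> e; case eE: (e \in E); last by exists v0; rewrite /Q eE.
have /set0Pn[v ve] := edge_neq0 r_gt1 (Er eE).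
case: (Order.TotalTheory.arg_maxP degree ve) => w we wmax; exists w => _; split=> //.
Qed.

Lemma sum_indicator (T : finType) (A : {set T}) : \sum_v (v \in A)%:R = #|A|%:R :> R.
Proof. by rewrite -sum1_card natr_sum [RHS]big_mkcond; apply: eq_bigr => v _; case: ifP. Qed.

Lemma sum_degree : \sum_v degree v = r%:R * N.
Proof.
rewrite /degree exchange_big /= -[N]sumr_const mulr_sumr; apply: eq_bigr => e /Er er.
by rewrite sum_indicator er mulr1.
Qed.

Let codeg v w : R := \sum_(e in E) (v \in e)%:R * (w \in e)%:R.

(** The left side counts pairs of edges e, f with two distinct vertices in both; for
    e <> f such a pair has overlap, and p^2 <= P(1_e 1_f). *)
Lemma joint_energy :
  p ^+ 2 * \sum_v \sum_(w | w != v) codeg v w ^+ 2 <= r%:R ^+ 2 * (N * p ^+ 2 + S).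
Proof.
have -> : \sum_v \sum_(w | w != v) codeg v w ^+ 2 = \sum_(e in E) \sum_(f in E)
    \sum_v \sum_(w | w != v) (v \in e :&: f)%:R * (w \in e :&: f)%:R.
  under [RHS]eq_bigr => e _ do rewrite exchange_big /=.
  rewrite [RHS]exchange_big; apply: eq_bigr => v _.
  under [RHS]eq_bigr => e _ do rewrite exchange_big /=.
  rewrite [RHS]exchange_big; apply: eq_bigr => w _.
  rewrite expr2 /codeg mulr_suml; apply: eq_bigr => e _.
  rewrite mulr_sumr; apply: eq_bigr => f _; rewrite -!natrM !mulnb !inE.
  by congr ((_ : bool)%:R); do 4!case: (_ \in _).
pose t e f : R := \sum_v \sum_(w | w != v) (v \in e :&: f)%:R * (w \in e :&: f)%:R.
have t_le e f : e \in E -> t e f <= r%:R ^+ 2.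
  move=> eE; apply: (@le_trans _ _ (\sum_v \sum_w (v \in e :&: f)%:R * (w \in e :&: f)%:R)).
    apply: ler_sum => v _; rewrite [leRHS](bigID (fun w => w != v)) /= lerDl.
    by apply: sumr_ge0 => w _; rewrite mulr_ge0.
  under eq_bigr => v _ do rewrite -mulr_sumr sum_indicator.
  rewrite -mulr_suml sum_indicator -expr2 lerXn2r ?nnegrE // ler_nat -(Er eE).
  by rewrite subset_leq_card // subsetIl.
have t0 e f : (#|e :&: f| <= 1)%N -> t e f = 0.
  move=> /card_le1P ef; apply: big1 => v _; apply: big1 => w wv.
  case ve: (v \in e :&: f); last by rewrite mul0r.
  by rewrite (ef _ ve) inE (negPf wv) mulr0.
apply: (@le_trans _ _ (\sum_(e in E) (r%:R ^+ 2 * p ^+ 2 +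
    \sum_(f in E | (f != e) && (1 < #|e :&: f|)%N) r%:R ^+ 2 * both e f))).
  rewrite mulr_sumr; apply: ler_sum => e eE; rewrite (bigD1 e) //= mulrDr.
  rewrite lerD //; first by rewrite mulrC ler_wpM2r ?sqr_ge0 // t_le.
  rewrite mulr_sumr big_mkcondr [leRHS]big_mkcondr; apply: ler_sum => f fE.
  case: (f =P e) => //= _; case: ltnP => [ef|/t0 t00]; last by rewrite -/(t e f) t00 mulr0.
  rewrite mulrC ler_pM ?sqr_ge0 ?t_le //.
    by apply: sumr_ge0 => v _; apply: sumr_ge0 => w _; rewrite mulr_ge0.
  have := both_gt_indep R c_gt1 r_gt1 (Er eE) (Er fE) ef; have := sqr_ge0 p.
  by lra.
rewrite big_split /= sumr_const -[X in X + _ <= _]mulr_natl mulrDr lerD //.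
  by rewrite [leRHS]mulrCA.
by rewrite mulr_sumr; apply: ler_sum => e _; rewrite mulr_sumr.
Qed.

Section WithHub.
Variable h : {set V} -> V.
Hypothesis hub : forall e, e \in E ->
  h e \in e /\ forall v, v \in e -> degree v <= degree (h e).

Lemma degree_ge0 v : 0 <= degree v.
Proof. exact: sumr_ge0. Qed.

(** If w is the hub of an edge that contains v, then deg v <= deg w, so that
    (deg v)^2 <= deg v * deg w, and 2 s m (deg v) <= m^2 + s^2 deg v * deg w, where m
    is the number of edges with hub w that contain v. The sum of deg v * deg w over
    all pairs is the square of the sum of the degrees. The parameter s replaces a
    square root. *)
Lemma off_hub_degree s : 0 <= s ->
  2 * s * (\sum_(e in E) \sum_(v in e :\ h e) degree v)
  <= \sum_v \sum_(w | w != v) codeg v w ^+ 2 + s ^+ 2 * (r%:R * N) ^+ 2.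
Proof.
move=> s0; pose m v w : R := \sum_(e in E) (v \in e)%:R * (h e == w)%:R.
have -> : \sum_(e in E) \sum_(v in e :\ h e) degree v =
    \sum_v \sum_(w | w != v) m v w * degree v.
  transitivity (\sum_(e in E) \sum_v \sum_(w | w != v)
      (v \in e)%:R * (h e == w)%:R * degree v).
    apply: eq_bigr => e _; rewrite big_mkcond; apply: eq_bigr => v _.
    rewrite !inE; have [->|vh] /= := eqVneq v (h e).
      by rewrite big1 // => w wv; rewrite eq_sym (negPf wv) mulr0 mul0r.
    case: (v \in e); last by rewrite big1 // => w _; rewrite !mul0r.
    rewrite (bigD1 (h e)) 1?eq_sym //= eqxx !mul1r big1 ?addr0 // => w /andP[_ wh].
    by rewrite eq_sym (negPf wh) mulr0 mul0r.
  rewrite exchange_big; apply: eq_bigr => v _; rewrite exchange_big.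
  by apply: eq_bigr => w _; rewrite mulr_suml.
have -> : (r%:R * N) ^+ 2 = \sum_v \sum_w degree v * degree w.
  rewrite -sum_degree expr2 mulr_suml.
  by apply: eq_bigr => v _; rewrite mulr_sumr.
rewrite !mulr_sumr -big_split /=; apply: ler_sum => v _.
apply: (@le_trans _ _ (\sum_(w | w != v) codeg v w ^+ 2 +
    s ^+ 2 * \sum_(w | w != v) degree v * degree w)); last first.
  rewrite lerD2l ler_wpM2l ?sqr_ge0 // [leRHS](bigID (fun w => w != v)) /= lerDl.
  by apply: sumr_ge0 => w _; rewrite mulr_ge0 ?degree_ge0.
rewrite !mulr_sumr -big_split /=; apply: ler_sum => w _.
have m0 : 0 <= m v w by apply: sumr_ge0 => e _; rewrite mulr_ge0.
have mj : m v w <= codeg v w.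
  apply: ler_sum => e eE; rewrite ler_wpM2l //.
  by case: eqP => // <-; have [-> _] := hub eE.
have dv := degree_ge0 v; have dw := degree_ge0 w.
apply: (@le_trans _ _ (m v w ^+ 2 + s ^+ 2 * (degree v * degree w))); last first.
  by rewrite lerD2r lerXn2r ?nnegrE // (le_trans m0).
have [mz|mnz] := eqVneq (m v w) 0.
  by rewrite mz !mul0r mulr0 addr_ge0 ?sqr_ge0 // mulr_ge0 ?sqr_ge0 // mulr_ge0.
have vw : degree v <= degree w.
  have /existsP[e /and3P[eE ve /eqP hw]] :
      [exists e, [&& e \in E, v \in e & h e == w]].
    apply: contraNT mnz => /existsPn nE; apply/eqP/big1 => e eE; have := nE e.
    by rewrite eE /=; case: (v \in e); case: (h e == w); rewrite ?mulr0 ?mul0r.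
  by rewrite -hw; have [_ ->] := hub eE.
have dvw : degree v ^+ 2 <= degree v * degree w by rewrite expr2 ler_wpM2l.
have := ler_wpM2l (sqr_ge0 s) dvw; have := sqr_ge0 (m v w - s * degree v).
rewrite sqrrB exprMn; lra.
Qed.

(** A near edge f of e either has two vertices in common with e, and is then part of
    the overlap, or meets e in one vertex v other than the hub; there are at most
    deg v such edges, each of probability p^2 together with e. *)
Lemma near_sum_le s : 0 < s ->
  \sum_(e in E) \sum_(f in E | (f != e) && near_edge h e f) (both e f + p ^+ 2)
  <= 2 * S + (r%:R ^+ 2 * (N * p ^+ 2 + S)) / s + s * r%:R ^+ 2 * (N * p) ^+ 2.
Proof.
move=> s0.
apply: (@le_trans _ _ (2 * S + 2 * p ^+ 2 *
    (\sum_(e in E) \sum_(v in e :\ h e) degree v))).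
  rewrite /overlap !mulr_sumr -big_split /=; apply: ler_sum => e eE.
  have -> : \sum_(v in e :\ h e) degree v =
      \sum_(f in E) \sum_(v in e :\ h e) (v \in f)%:R by rewrite exchange_big.
  rewrite !mulr_sumr big_mkcondr [X in _ <= X + _]big_mkcondr -big_split /=.
  apply: ler_sum => f fE.
  have tail0 : 0 <= 2 * p ^+ 2 * (\sum_(v in e :\ h e) (v \in f)%:R).
    by rewrite mulr_ge0 ?sumr_ge0 // mulr_ge0 ?sqr_ge0.
  case: (f =P e) => /= [_|fe]; first by rewrite add0r.
  case: ltnP => ef.
    have := both_gt_indep R c_gt1 r_gt1 (Er eE) (Er fE) ef.
    have := both_ge0 R c_gt0 e f; have := sqr_ge0 p; case: ifP => _; lra.
  rewrite add0r; case: ifP => // /set0Pn[v /setIP[ve vf]].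
  rewrite (both_far R c_gt1 r_gt1 (Er eE) (Er fE) ef) (bigD1 v) //= vf mulrDr mulr1.
  have -> : p ^+ 2 + p ^+ 2 = 2 * p ^+ 2 by ring.
  by rewrite lerDl mulr_ge0 ?sumr_ge0 // mulr_ge0 ?sqr_ge0.
have D := ler_wpM2l (sqr_ge0 p) (off_hub_degree (ltW s0)).
rewrite -addrA lerD2l -(ler_pM2l s0) mulrDr [X in _ <= X + _]mulrCA mulfV ?gt_eqF // mulr1.
have := joint_energy.
move: D; rewrite mulrDr; move: (\sum_(e in E) _) (\sum_v _) => D J.
have -> : p ^+ 2 * (2 * s * D) = s * (2 * p ^+ 2 * D) by ring.
have -> : p ^+ 2 * (s ^+ 2 * (r%:R * N) ^+ 2) = s * (s * r%:R ^+ 2 * (N * p) ^+ 2) by ring.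
lra.
Qed.

End WithHub.

Lemma avg_prod_approx (u : {set V} -> R) (s : R) : (forall e, 0 <= u e <= 1) -> 0 < s ->
  `|avg (fun x => \prod_(e in E) (1 - u e * (mono x e)%:R))
    - expR (- \sum_(e in E) u e * p)|
  <= N * p ^+ 2 + (2 * S + (r%:R ^+ 2 * (N * p ^+ 2 + S)) / s
                   + s * r%:R ^+ 2 * (N * p) ^+ 2).
Proof.
move=> u01 s0.
(* without edges there may be no vertex to serve as a hub *)
have [E0|En0] := eqVneq E set0.
  have S0 : S = 0 by rewrite /overlap E0 big_set0.
  rewrite S0 E0 cards0 !big_set0 oppr0 expR0 (eq_avg (G := fun=> 1)).
    by rewrite avg_cst // subrr normr0 !mul0r; lra.
  by move=> x; rewrite big_set0.
have [h hub] := exists_hub En0.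
have hE e : e \in enum E -> #|e| = r /\ h e \in e.
  by rewrite mem_enum => eE; rewrite Er //; have [] := hub e eE.
have := avg_prod1B c_gt0 u01 (enum_uniq E) hE.
rewrite [\sum_(e <- enum E) u e * p]big_enum /=.
under eq_avg => x do rewrite big_enum /=.
move/le_trans; apply; rewrite big_enum /= big_split /= sumr_const -[X in X + _ <= _]mulr_natl lerD2l.
under eq_bigr => e _ do rewrite big_enum_cond /=.
exact: near_sum_le.
Qed.

End Hubs.

(** * Limit of the generating function of the two counts *)

Section TwoLayers.
Import mathcomp.boot.finset.
Variables (R : realType) (V : finType) (c r : nat) (A B : {set {set V}}) (a b : R).
Hypotheses (a01 : 0 <= a <= 1) (b01 : 0 <= b <= 1).
Implicit Types (x : {ffun V -> 'I_c}) (e : {set V}).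

(** This is 1 - z, where z is the product of a (if e lies in A) and b (if e lies
    in B). The inclusion-exclusion form makes the sum over the edges immediate. *)
Definition thinning e : R :=
  (1 - a) * (e \in A)%:R + (1 - b) * (e \in B)%:R
  - (1 - a) * (1 - b) * (e \in A :&: B)%:R.

Lemma thinning01 e : 0 <= thinning e <= 1.
Proof.
rewrite /thinning inE; move: a01 b01 => /andP[a0 a1] /andP[b0 b1].
have ab := mulr_ge0 a0 b0; have ab1 := mulr_ile1 a0 b0 a1 b1.
have ab' : 0 <= (1 - a) * (1 - b) by rewrite mulr_ge0 ?subr_ge0.
by case: (e \in A); case: (e \in B) => /=; rewrite ?mulr1 ?mulr0; apply/andP; split; lra.
Qed.

Lemma sum_thinning (q : R) : \sum_(e in A :|: B) thinning e * q =
  (1 - a) * (#|A|%:R * q) + (1 - b) * (#|B|%:R * q)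
  - (1 - a) * (1 - b) * (#|A :&: B|%:R * q).
Proof.
have sub (C : {set {set V}}) : C \subset A :|: B ->
    \sum_(e in A :|: B) (e \in C)%:R = #|C|%:R :> R.
  move=> CAB; rewrite -sum_indicator [RHS](bigID (mem (A :|: B))) /= [X in _ + X]big1 ?addr0 //.
  by move=> e; apply: contraNeq; rewrite pnatr_eq0 eqb0 negbK => /(fintype.subsetP CAB).
rewrite -mulr_suml /thinning sumrB big_split /= -!mulr_sumr !sub; first by ring.
- exact: fintype.subset_trans (subsetIl _ _) (subsetUl _ _).
- exact: subsetUr.
- exact: subsetUl.
Qed.

Lemma prod_thinning x :
  a ^+ (\sum_(e in A) mono x e)%N * b ^+ (\sum_(e in B) mono x e)%N
  = \prod_(e in A :|: B) (1 - thinning e * (mono x e)%:R).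
Proof.
have pow (C : {set {set V}}) (z : R) : C \subset A :|: B ->
    z ^+ (\sum_(e in C) mono x e)%N =
    \prod_(e in A :|: B) (if e \in C then z ^+ (mono x e) else 1).
  move=> CAB; rewrite expr_sum big_mkcond [RHS]big_mkcond; apply: eq_bigr => e _.
  by case: ifP => [eC|_]; [rewrite (fintype.subsetP CAB _ eC) | case: ifP].
rewrite !pow ?subsetUl ?subsetUr // -big_split /=; apply: eq_bigr => e _.
rewrite /thinning inE; case: (e \in A); case: (e \in B); case: (monochromatic _ _) => /=;
  rewrite ?expr0 ?expr1; ring.
Qed.

End TwoLayers.

Section Asymptotics.
Import mathcomp.boot.finset.
Local Open Scope classical_set_scope.
Variables (R : realType) (V : nat -> finType) (c : nat -> nat) (r : nat).
Variables (A B : forall n, {set {set (V n)}}) (l1 l2 l12 : R).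
Hypotheses (r_gt1 : (1 < r)%N) (c_gt0 : forall n, (0 < c n)%N).
Hypothesis c_oo : c n @[n --> \oo] --> \oo.
Hypotheses (Ar : forall n, uniform_edges r (A n)) (Br : forall n, uniform_edges r (B n)).
Local Notation p n := ((c n ^ r.-1)%:R^-1 : R).
Local Notation avg n := (@avg R (V n) (c n)).
Local Notation covar n := (@covar R (V n) (c n)).
Local Notation overlap n := (@overlap R (V n) (c n)).
Hypothesis EA : avg n (count_mono R (A n)) @[n --> \oo] --> l1.
Hypothesis EB : avg n (count_mono R (B n)) @[n --> \oo] --> l2.
Hypothesis VA : covar n (A n) (A n) @[n --> \oo] --> l1.
Hypothesis VB : covar n (B n) (B n) @[n --> \oo] --> l2.
Hypothesis VAB : covar n (A n) (B n) @[n --> \oo] --> l12.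

Let c_gt1 : \forall n \near \oo, (1 < c n)%N.
Proof. exact: (c_oo (nbhs_infty_gt 1)). Qed.

Let cV_cvg0 : (c n)%:R^-1 @[n --> \oo] --> (0 : R).
Proof.
apply/(gtr0_cvgV0 (f := fun n => (c n)%:R)); last exact/cvgrnyP.
by near=> n; rewrite ltr0n.
Unshelve. all: by end_near. Qed.

Let p_cvg0 : p n @[n --> \oo] --> (0 : R).
Proof.
apply: (squeeze_cvgr _ (cvg_cst 0) cV_cvg0); near=> n.
rewrite invr_ge0 ler0n /= lef_pV2 ?posrE ?ltr0n ?expn_gt0 ?c_gt0 // ler_nat.
by rewrite -[leqLHS]expn1 leq_pexp2l ?c_gt0 // -ltnS prednK // ltnW.
Unshelve. all: by end_near. Qed.

Let NA : #|A n|%:R * p n @[n --> \oo] --> l1.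
Proof.
apply: cvg_trans EA; apply: near_eq_cvg; near=> n.
have c1 : (1 < c n)%N by near: n.
by rewrite (avg_count_mono R c1 r_gt1 (@Ar n)).
Unshelve. all: by end_near. Qed.

Let NB : #|B n|%:R * p n @[n --> \oo] --> l2.
Proof.
apply: cvg_trans EB; apply: near_eq_cvg; near=> n.
have c1 : (1 < c n)%N by near: n.
by rewrite (avg_count_mono R c1 r_gt1 (@Br n)).
Unshelve. all: by end_near. Qed.

(** The variance exceeds the mean by at least half of the overlap, up to N p^2. *)
Let self_overlap (C : forall n, {set {set (V n)}}) (l : R) :
  (forall n, uniform_edges r (C n)) ->
  #|C n|%:R * p n @[n --> \oo] --> l -> covar n (C n) (C n) @[n --> \oo] --> l ->
  overlap n (C n) (C n) @[n --> \oo] --> (0 : R).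
Proof.
move=> Cr CN CV.
have lim0 : (covar n (C n) (C n) - (#|C n|%:R * p n - #|C n|%:R * p n * p n)) * 2
    @[n --> \oo] --> (0 : R).
  have -> : (0 : R) = (l - (l - l * 0)) * 2 by rewrite mulr0 subr0 subrr mul0r.
  apply: cvgMr_tmp; apply: cvgB => //; apply: cvgB => //; exact: cvgM.
apply: (squeeze_cvgr _ (cvg_cst 0) lim0); near=> n.
have c1 : (1 < c n)%N by near: n.
rewrite overlap_ge0 //=; have := covar_split R c1 r_gt1 (Cr n) (Cr n).
rewrite setIid => /andP[]; lra.
Unshelve. all: by end_near. Qed.

Local Notation E n := (A n :|: B n).
Local Notation S n := (overlap n (E n) (E n)).

Let union_overlap : S n @[n --> \oo] --> (0 : R).
Proof.
have lim0 : (2 ^ r.+1)%:R * (overlap n (A n) (A n) + overlap n (B n) (B n)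
    + (#|A n|%:R * p n + #|B n|%:R * p n) * (c n)%:R^-1) @[n --> \oo] --> (0 : R).
  have -> : (0 : R) = (2 ^ r.+1)%:R * (0 + 0 + (l1 + l2) * 0) by ring.
  apply: cvgMl_tmp; apply: cvgD; first apply: cvgD.
  - exact: self_overlap NA VA.
  - exact: self_overlap NB VB.
  - by apply: cvgM => //; apply: cvgD.
apply: (squeeze_cvgr _ (cvg_cst 0) lim0); near=> n.
have c1 : (1 < c n)%N by near: n.
by rewrite overlap_ge0 //= -mulrDl overlapU.
Unshelve. all: by end_near. Qed.

(** By covar_split, the covariance differs from the expected number of common
    monochromatic edges by at most the overlap between the layers and N p^2. *)
Let NAB : #|A n :&: B n|%:R * p n @[n --> \oo] --> l12.
Proof.
have lower : covar n (A n) (B n) - S n @[n --> \oo] --> l12.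
  by rewrite -[l12]subr0; apply: cvgB.
have upper : covar n (A n) (B n) + #|A n|%:R * p n * p n @[n --> \oo] --> l12.
  by rewrite -[l12]addr0 -[X in _ + X](mulr0 l1); apply: cvgD => //; apply: cvgM.
apply: (squeeze_cvgr _ lower upper); near=> n.
have c1 : (1 < c n)%N by near: n.
have := covar_split R c1 r_gt1 (@Ar n) (@Br n).
have := overlap_cross R c1 (subsetUl (A n) (B n)) (subsetUr (A n) (B n)).
have := overlap_ge0 R c1 (A n) (B n).
have : #|A n :&: B n|%:R * p n * p n <= #|A n|%:R * p n * p n.
  by rewrite !ler_wpM2r ?ler_nat // subset_leq_card // subsetIl.
have : 0 <= #|A n :&: B n|%:R * p n * p n by rewrite !mulr_ge0.
by move=> h1 h2 h3 h4 /andP[h5 h6]; apply/andP; split; lra.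
Unshelve. all: by end_near. Qed.

(** For fixed s the error of avg_prod_approx tends to s times a constant; s is arbitrary. *)
Lemma pgf_cvg (a b : R) : 0 <= a <= 1 -> 0 <= b <= 1 ->
  avg n (fun x => a ^+ (\sum_(e in A n) mono x e)%N * b ^+ (\sum_(e in B n) mono x e)%N)
  @[n --> \oo] -->
  expR (- ((1 - a) * l1 + (1 - b) * l2 - (1 - a) * (1 - b) * l12)).
Proof.
move=> a01 b01; pose u n := thinning (A n) (B n) a b.
have expo : expR (- \sum_(e in E n) u n e * p n) @[n --> \oo] -->
    expR (- ((1 - a) * l1 + (1 - b) * l2 - (1 - a) * (1 - b) * l12)).
  apply: continuous_cvg; first exact: continuous_expR.
  rewrite /u; under eq_fun do rewrite sum_thinning.
  by apply: cvgN; apply: cvgB; [apply: cvgD; apply: cvgMl_tmp | apply: cvgMl_tmp].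
pose L := l1 + l2 - l12.
have NE : #|E n|%:R * p n @[n --> \oo] --> L.
  have -> : (fun n => #|E n|%:R * p n) = (fun n =>
      #|A n|%:R * p n + #|B n|%:R * p n - #|A n :&: B n|%:R * p n).
    apply/funext => n; rewrite -mulrDl -natrD -cardsUI natrD mulrDl addrK //.
  by apply: cvgB => //; apply: cvgD.
pose err s n : R := #|E n|%:R * p n ^+ 2 + (2 * S n +
  (r%:R ^+ 2 * (#|E n|%:R * p n ^+ 2 + S n)) / s + s * r%:R ^+ 2 * (#|E n|%:R * p n) ^+ 2).
have NE2 : #|E n|%:R * p n ^+ 2 @[n --> \oo] --> (0 : R).
  have -> : (0 : R) = L * 0 by rewrite mulr0.
  by under eq_fun do rewrite expr2 mulrA; apply: cvgM.
have err_cvg s : err s n @[n --> \oo] --> s * r%:R ^+ 2 * L ^+ 2.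
  have -> : s * r%:R ^+ 2 * L ^+ 2 = 0 + (2 * 0 + (r%:R ^+ 2 * (0 + 0)) / s +
      s * r%:R ^+ 2 * L ^+ 2) by ring.
  apply: cvgD => //; apply: cvgD; last first.
    apply: cvgMl_tmp; under eq_fun do rewrite expr2.
    by rewrite expr2; apply: cvgM.
  apply: cvgD; first exact: cvgMl_tmp.
  by apply: cvgMr_tmp; apply: cvgMl_tmp; apply: cvgD.
have -> : expR (- ((1 - a) * l1 + (1 - b) * l2 - (1 - a) * (1 - b) * l12)) =
  0 + expR (- ((1 - a) * l1 + (1 - b) * l2 - (1 - a) * (1 - b) * l12)) by rewrite add0r.
under eq_fun => n do rewrite -[avg n _](subrK (expR (- \sum_(e in E n) u n e * p n))).
apply: cvgD => //; apply/cvgrPdist_lt => eps eps0.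
have [s s0 sL] : exists2 s, 0 < s & s * r%:R ^+ 2 * L ^+ 2 < eps.
  have K0 : 0 <= r%:R ^+ 2 * L ^+ 2 by rewrite -exprMn sqr_ge0.
  (* the added 1 covers L = 0 *)
  exists (eps / (r%:R ^+ 2 * L ^+ 2 + 1)); first by rewrite divr_gt0 // ltr_wpDl.
  rewrite -(mulrA _ (r%:R ^+ 2)) [ltLHS]mulrAC ltr_pdivrMr ?ltr_wpDl //.
  by rewrite ltr_pM2l // ltrDl.
have err_lt := cvgr_lt _ (err_cvg s) _ sL.
near=> n; rewrite sub0r normrN.
have c1 : (1 < c n)%N by near: n.
have en : err s n < eps by near: n; exact: err_lt.
apply: le_lt_trans en.
have Er : uniform_edges r (E n) by move=> e /setUP[/Ar|/Br].
have := avg_prod_approx c1 r_gt1 Er (thinning01 (A n) (B n) a01 b01) s0.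
by move/(le_trans _); apply; rewrite (eq_avg (prod_thinning _ _ _ _)).
Unshelve. all: by end_near. Qed.

End Asymptotics.

Local Open Scope classical_set_scope.
Local Open Scope ring_scope.

(** * From random colours to the finite average *)

(** Every subset of a countable type is a countable union of points, so
    functions of countably-valued random elements raise no measurability question. *)
Lemma measurable_countable_preimage (d : measure_display) (W : measurableType d)
    (T : countType) (S : W -> T) (Y : set T) :
  (forall t, measurable (S @^-1` [set t])) -> measurable (S @^-1` Y).
Proof.
move=> mS.
have -> : S @^-1` Y = \bigcup_(t in [set: T])
    (if t \in Y then S @^-1` [set t] else set0).
  apply/seteqP; split=> w /=; first by move=> Yw; exists (S w) => //; rewrite mem_set.
  by case=> t _; case: ifPn => // /set_mem Yt /= ->.
by apply: countable_bigcupT_measurable => // t; case: ifP.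
Qed.

Lemma measurable_countable_factor (d : measure_display) (W : measurableType d)
    (R : realType) (T : countType) (S : W -> T) (h : T -> R) :
  (forall t, measurable (S @^-1` [set t])) -> measurable_fun [set: W] (h \o S).
Proof.
by move=> mS _ Y _; rewrite setTI comp_preimage; apply: measurable_countable_preimage.
Qed.

Section Transfer.
Variables (R : realType) (d : measure_display) (W : measurableType d).
Variables (P : probability W R) (V : finType) (c : nat) (X : V -> {RV P >-> nat}).
Hypothesis hX : uniform_coloring c X.
Implicit Types (x : {ffun V -> 'I_c}) (t : {ffun V -> nat}).

Definition joint_coloring (w : W) : {ffun V -> nat} := [ffun v => X v w].
Local Notation S := joint_coloring.

Let fiberE t : S @^-1` [set t] =
  \bigcap_(v in [set` [set: V]%SET]) (X v @^-1` [set t v]).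
Proof.
apply/seteqP; split=> w /= Sw; first by move=> v _ /=; rewrite -Sw ffunE.
by apply/ffunP => v; rewrite ffunE; apply: Sw; rewrite /= inE.
Qed.

Lemma measurable_joint_coloring t : measurable (S @^-1` [set t]).
Proof.
rewrite fiberE; apply: fin_bigcap_measurable => // v _.
by rewrite -[X in measurable X]setTI; apply: measurable_funP.
Qed.

Let shade x : {ffun V -> nat} := [ffun v => (x v).+1].

Let prob_fiber x : P (S @^-1` [set shade x]) = ((c ^ #|V|)%:R^-1)%:E.
Proof.
have [_ uni ind] := hX; rewrite fiberE.
rewrite (ind [set: V]%SET (fun v => [set shade x v])) //.
under eq_bigr => v _ do rewrite ffunE uni ?ltn_ord //.
rewrite prodEFin prodr_const cardsT natrX exprVn //.
Qed.

Let shade_inj : injective shade.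
Proof.
move=> x y xy; apply/ffunP => v; apply/val_inj.
by have := congr1 (fun t : {ffun V -> nat} => t v) xy; rewrite !ffunE => -[].
Qed.

(** The event that all colours lie in 1, ..., c is a disjoint union of fibers, of total
    probability 1. *)
Let palettes : set W :=
  \bigcup_(x in [set` enum {ffun V -> 'I_c}]) (S @^-1` [set shade x]).

Let measurable_palettes : measurable palettes.
Proof. by apply: fin_bigcup_measurable => // x _; exact: measurable_joint_coloring. Qed.

Let palettes_sure : P (~` palettes) = 0%E.
Proof.
have mS := measurable_joint_coloring.
have [c0 _ _] := hX; rewrite probability_setC // /palettes measure_fin_bigcup //; last first.
  by move=> x y _ _ [w [/= Sx Sy]]; apply: shade_inj; rewrite -Sx -Sy.
rewrite -fsbig_seq ?enum_uniq // (eq_bigr _ (fun x _ => prob_fiber x)) sumEFin big_enum /=.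
rewrite sumr_const card_ffun card_ord -[_^-1 *+ _]mulr_natr mulVf ?subee //.
by rewrite pnatr_eq0 -lt0n expn_gt0 c0.
Qed.

(** All moments of the two counts become averages over the finite set of colourings.
    As g takes finitely many values almost surely, its integral is a finite sum. *)
Lemma expectation_coloring (g : (V -> nat) -> R) :
  ('E_P[fun w => g (fun v => X v w)] = (avg (fun x => g (palette x)))%:E)%E.
Proof.
rewrite unlock; have mS := measurable_joint_coloring.
pose G (w : W) : \bar R := (\sum_(x : {ffun V -> 'I_c})
  (g (palette x))%:E * (\1_(S @^-1` [set shade x]) w)%:E)%E.
have intG x : P.-integrable setT
    (fun w => (g (palette x))%:E * (\1_(S @^-1` [set shade x]) w)%:E)%E.
  by apply: integrableZl => //; apply: integrable_indic.
rewrite (ae_eq_integral G) //.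
- rewrite /G integral_sum //.
  rewrite /avg mulr_suml -sumEFin; apply: eq_bigr => x _.
  rewrite integralZl //; last exact: integrable_indic.
  by rewrite integral_indic // setIT EFinM; congr (_ * _)%E; exact: prob_fiber.
- apply/measurable_EFinP.
  have -> : (fun w => g (fun v => X v w)) =
      (fun t : {ffun V -> nat} => g (fun v => t v)) \o S.
    by apply/funext => w /=; congr g; apply/funext => v; rewrite ffunE.
  exact: measurable_countable_factor.
- by apply: (measurable_int P); apply: integrable_sum.
exists (~` palettes); split=> //; first exact: measurableC.
apply: subsetC => w [x _ /= Sx] _; rewrite /G (bigD1 x) //= big1 ?adde0.
  rewrite indicE mem_set // mule1; congr (g _)%:E; apply/funext => v.
  by have := congr1 (fun t : {ffun V -> nat} => t v) Sx; rewrite !ffunE.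
move=> y yx; rewrite indicE memNset ?mule0 //= => Sy.
by move/eqP: yx; apply; apply: shade_inj; rewrite -Sx -Sy.
Qed.

End Transfer.

(** * Convergence of generating functions implies convergence in law *)

Section Mean.
Variables (R : realType) (d : measure_display) (W : measurableType d).
Variables (P : probability W R) (T : countType) (S : W -> T).
Hypothesis mS : forall t, measurable (S @^-1` [set t]).
Implicit Types (g h : T -> R) (M : R).

Definition mean g : R := fine 'E_P[g \o S]%E.

Lemma meanE g : mean g = \int[P]_w g (S w).
Proof. by rewrite /mean unlock. Qed.

Lemma integrable_bounded_comp g M : (forall t, `|g t| <= M) ->
  P.-integrable setT (EFin \o (fun w => g (S w))).
Proof.
move=> gM; apply: measurable_bounded_integrable => //.
  by rewrite fin_num_fun_lty.
  exact: measurable_countable_factor.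
exists M; split; first exact: num_real.
by move=> x Mx w _ /=; apply: le_trans (gM _) (ltW Mx).
Qed.

Lemma expectation_mean g M : (forall t, `|g t| <= M) -> 'E_P[g \o S]%E = (mean g)%:E.
Proof.
move=> gM; rewrite /mean fineK // unlock.
by apply: integrable_fin_num => //; apply: integrable_bounded_comp gM.
Qed.

Lemma mean_cst k : mean (fun=> k) = k.
Proof. by rewrite meanE Rintegral_cst //= probability_setT mulr1. Qed.

Lemma meanD g h M N : (forall t, `|g t| <= M) -> (forall t, `|h t| <= N) ->
  mean (fun t => g t + h t) = mean g + mean h.
Proof.
by move=> gM hN; rewrite !meanE RintegralD //;
  [exact: integrable_bounded_comp gM | exact: integrable_bounded_comp hN].
Qed.

Lemma meanZ k g M : (forall t, `|g t| <= M) -> mean (fun t => k * g t) = k * mean g.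
Proof.
by move=> gM; rewrite !meanE RintegralZl //; exact: integrable_bounded_comp gM.
Qed.

Lemma ler_mean g h M N : (forall t, `|g t| <= M) -> (forall t, `|h t| <= N) ->
  (forall t, g t <= h t) -> mean g <= mean h.
Proof.
move=> gM hN gh; rewrite !meanE; apply: le_Rintegral => //.
- exact: integrable_bounded_comp gM.
- exact: integrable_bounded_comp hN.
Qed.

Lemma mean_dist g h k M N K : (forall t, `|g t| <= M) -> (forall t, `|h t| <= N) ->
  (forall t, `|k t| <= K) ->
  (forall t, `|g t - h t| <= k t) -> `|mean g - mean h| <= mean k.
Proof.
move=> gM hN kK ghk.
have hkM t : `|h t + k t| <= N + K by apply: le_trans (ler_normD _ _) (lerD _ _).
have gkM t : `|g t + k t| <= M + K by apply: le_trans (ler_normD _ _) (lerD _ _).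
rewrite ler_distlC lerBlDr -(meanD gM kK) -(meanD hN kK); apply/andP; split.
  by apply: (ler_mean gM hkM) => t; have := ghk t; rewrite ler_distlC lerBlDr => /andP[].
by apply: (ler_mean hN gkM) => t; have := ghk t; rewrite ler_distlC => /andP[].
Qed.

Lemma mean_indicator (Q : pred T) :
  mean (fun t => (Q t)%:R) = fine (P (S @^-1` [set` Q])).
Proof.
have mQ : measurable (S @^-1` [set` Q]) by exact: measurable_countable_preimage.
rewrite meanE /Rintegral; congr fine.
under eq_integral => w _.
  have -> : (Q (S w))%:R = \1_(S @^-1` [set` Q]) w :> R.
    by rewrite indicE; congr ((_ : bool)%:R); apply/idP/idP => [?|/set_mem //]; apply/mem_set.
  over.
by rewrite integral_indic // setIT.
Qed.

End Mean.

Section PgfConvergence.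
Variables (R : realType) (d : nat -> measure_display).
Variables (W : forall n, measurableType (d n)) (P : forall n, probability (W n) R).
Variables (d' : measure_display) (W' : measurableType d') (P' : probability W' R).

Section Test.
Variables (T : countType) (S : forall n, W n -> T) (S' : W' -> T).
Hypothesis mS : forall n t, measurable (@S n @^-1` [set t]).
Hypothesis mS' : forall t, measurable (S' @^-1` [set t]).
Implicit Types (g h : T -> R).

(** The class of such functions is closed under linear combinations and uniform
    limits; it is enlarged from powers to indicators of points. *)
Definition tested g := (exists M, forall t, `|g t| <= M) /\
  mean (P n) (@S n) g @[n --> \oo] --> mean P' S' g.

Lemma testedD g h : tested g -> tested h -> tested (fun t => g t + h t).
Proof.
move=> [[M gM] cg] [[N hN] ch]; split.
  by exists (M + N) => t; apply: le_trans (ler_normD _ _) (lerD _ _).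
rewrite (meanD _ _ gM hN) //.
by under eq_fun do rewrite (meanD _ _ gM hN) //; apply: cvgD.
Qed.

Lemma testedZ k g : tested g -> tested (fun t => k * g t).
Proof.
move=> [[M gM] cg]; split; first by exists (`|k| * M) => t; rewrite normrM ler_wpM2l.
rewrite (meanZ _ _ _ gM) //.
by under eq_fun do rewrite (meanZ _ _ _ gM) //; apply: cvgMl_tmp.
Qed.

Lemma tested0 : tested (fun=> 0).
Proof.
split; first by exists 0 => t; rewrite normr0.
by rewrite mean_cst; under eq_fun do rewrite mean_cst; apply: cvg_cst.
Qed.

Lemma tested_sum (I : Type) (s : seq I) (F : I -> T -> R) :
  (forall i, tested (F i)) -> tested (fun t => \sum_(i <- s) F i t).
Proof.
move=> tF; elim: s => [|i s IH].
  by under eq_fun do rewrite big_nil; exact: tested0.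
by under eq_fun do rewrite big_cons; apply: testedD.
Qed.

Lemma tested_uniform g : (exists M, forall t, `|g t| <= M) ->
  (forall eps, 0 < eps -> exists2 h, tested h & forall t, `|g t - h t| <= eps) ->
  tested g.
Proof.
move=> [M gM] approx; split; first by exists M.
apply/cvgrPdist_lt => eps eps0.
have e3 : 0 < eps / 3 by rewrite divr_gt0.
have [h [[N hN] ch] gh] := approx _ e3.
have close (dd : measure_display) (Wd : measurableType dd) (Q : probability Wd R) (s : Wd -> T) :
    (forall t, measurable (s @^-1` [set t])) -> `|mean Q s g - mean Q s h| <= eps / 3.
  move=> ms; rewrite -[leRHS](mean_cst Q s).
  by apply: (mean_dist Q ms gM hN (K := `|eps / 3|)).
near=> n.
have h1 := close _ _ (P n) (@S n) (@mS n).
have h2 := close _ _ P' S' mS'.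
have h3 : `|mean P' S' h - mean (P n) (@S n) h| < eps / 3.
  by near: n; move/cvgrPdist_lt : ch; apply.
move: h1 h2 h3; rewrite !ler_norml !ltr_norml => /andP[? ?] /andP[? ?] /andP[? ?].
by apply/andP; split; lra.
Unshelve. all: by end_near. Qed.

(** By induction on k, the terms with q < k can be subtracted from F a^q. The rest,
    divided by a^k, is F a^(q - k) on the set q >= k, which is within a of the
    indicator of q = k times F. Then a tends to 0. *)
Lemma tested_fiber (F : T -> R) (q : T -> nat) : (forall t, `|F t| <= 1) ->
  (forall a, 0 <= a <= 1 -> tested (fun t => F t * a ^+ q t)) ->
  forall k, tested (fun t => F t * (q t == k)%:R).
Proof.
move=> F1 ta k; elim/ltn_ind: k => k IH; apply: tested_uniform.
  exists 1 => t; rewrite normrM (le_trans _ (F1 t)) // ler_piMr //.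
  by case: (_ == _); rewrite ?normr1 ?normr0.
(* a must be at most eps for the approximation and at most 1 for the hypothesis *)
move=> eps eps0; pose a := Num.min eps 1.
have a0 : 0 < a by rewrite lt_min eps0 ltr01.
have a1 : a <= 1 by rewrite ge_min lexx orbT.
have aeps : a <= eps by rewrite ge_min lexx.
exists (fun t => a ^- k * (F t * a ^+ q t +
    (-1) * \sum_(m <- iota 0 k) (if (m < k)%N then a ^+ m * (F t * (q t == m)%:R) else 0))).
  apply: testedZ; apply: testedD; first by apply: ta; rewrite (ltW a0).
  apply: testedZ; apply: tested_sum => m; case mk: (m < k)%N; last exact: tested0.
  by apply: testedZ; apply: IH.
move=> t.
have -> : \sum_(m <- iota 0 k) (if (m < k)%N then a ^+ m * (F t * (q t == m)%:R) else 0)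
    = if (q t < k)%N then a ^+ q t * F t else 0.
  have -> : iota 0 k = index_iota 0 k by rewrite /index_iota subn0.
  rewrite big_mkord.
  under eq_bigr => i _ do rewrite ltn_ord.
  case: ifP => [qk|/negbT qk].
    rewrite (bigD1 (Ordinal qk)) //= eqxx mulr1 big1 ?addr0 // => i iq.
    by rewrite -[q t]/(val (Ordinal qk)) val_eqE eq_sym (negPf iq) !mulr0.
  rewrite big1 // => i _; case: eqP => [qi|_]; last by rewrite !mulr0.
  by rewrite qi ltn_ord in qk.
case: (ltngtP (q t) k) => qk.
- by rewrite mulr0 mulN1r [F t * _]mulrC subrr mulr0 subrr normr0 ltW.
- rewrite mulr0 sub0r normrN !mulr0 addr0 mulrCA [a ^- k * _]mulrC -expfB //.
  rewrite normrM (le_trans _ aeps) // (le_trans (ler_piMl _ (F1 t))) //.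
  rewrite ger0_norm ?exprn_ge0 ?(ltW a0) //.
  by rewrite -[leRHS]expr1 ler_wiXn2l ?subn_gt0 // ltW.
rewrite qk mulr1 !mulr0 addr0 mulrCA mulVf ?mulr1 ?subrr ?normr0 ?(ltW eps0) //.
by rewrite expf_neq0 // gt_eqF.
Qed.

End Test.

Variables (S : forall n, W n -> nat * nat) (S' : W' -> nat * nat).
Hypothesis mS : forall n t, measurable (@S n @^-1` [set t]).
Hypothesis mS' : forall t, measurable (S' @^-1` [set t]).

Let box K (t : nat * nat) : bool := (t.1 < K)%N && (t.2 < K)%N.

Let box_cvg : mean P' S' (fun t => (box K t)%:R) @[K --> \oo] --> (1 : R).
Proof.
pose A K := S' @^-1` [set` box K].
have mA K : measurable (A K) by exact: measurable_countable_preimage.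
have AT : \bigcup_K A K = setT.
  apply/seteqP; split=> // w _; exists ((S' w).1 + (S' w).2).+1 => //=.
  by apply/andP; split; rewrite ltnS ?leq_addr ?leq_addl.
have ndA : nondecreasing_seq A.
  move=> K K' KK'; apply/subsetPset => w /andP[lt1 lt2].
  by apply/andP; split; [exact: leq_trans lt1 KK' | exact: leq_trans lt2 KK'].
under eq_fun do rewrite mean_indicator //.
apply: fine_cvg; have := nondecreasing_cvg_mu mA (bigcupT_measurable _ mA) ndA (mu := P').
by rewrite AT /= (_ : P' [set: W'] = 1%E) //; exact: probability_setT.
Qed.

(** Indicators of points are obtained one coordinate at a time. For a general g with
    bound M, the part of g outside a large finite box contributes at most M times the
    mass outside the box. This mass converges too, since the mass of the box does,
    and it is small in the limit. *)
Lemma cvg_mean_of_pgf :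
  (forall a b : R, 0 <= a <= 1 -> 0 <= b <= 1 ->
    mean (P n) (@S n) (fun t => a ^+ t.1 * b ^+ t.2) @[n --> \oo] -->
    mean P' S' (fun t => a ^+ t.1 * b ^+ t.2)) ->
  forall g M, (forall t, `|g t| <= M) ->
    mean (P n) (@S n) g @[n --> \oo] --> mean P' S' g.
Proof.
move=> pgf g M gM.
have pow1 (a : R) k : 0 <= a <= 1 -> `|a ^+ k| <= 1.
  by move=> /andP[a0 a1]; rewrite normrX exprn_ile1 // ger0_norm.
have t1 b k : 0 <= b <= 1 -> tested S S' (fun t => b ^+ t.2 * (t.1 == k)%:R).
  move=> b01; apply: (tested_fiber mS mS') => [t|a a01]; first exact: pow1.
  split; first by exists 1 => t; rewrite normrM mulr_ile1 ?pow1.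
  rewrite (_ : (fun t => _) = (fun t => a ^+ t.1 * b ^+ t.2)); first exact: pgf.
  by apply/funext => t; rewrite mulrC.
have t2 j k : tested S S' (fun t => (t.1 == j)%:R * (t.2 == k)%:R).
  apply: (tested_fiber mS mS') => [t|b b01]; first by case: (_ == _); rewrite ?normr1 ?normr0.
  rewrite (_ : (fun t => _) = (fun t => b ^+ t.2 * (t.1 == j)%:R)); first exact: t1.
  by apply/funext => t; rewrite mulrC.
have tbox (h : nat * nat -> R) K : tested S S' (fun t => h t * (box K t)%:R).
  rewrite (_ : (fun t => _) = (fun t => \sum_(j <- iota 0 K) \sum_(k <- iota 0 K)
      h (j, k) * ((t.1 == j)%:R * (t.2 == k)%:R))).
    apply: tested_sum => // j; apply: tested_sum => // k; exact: testedZ.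
  have -> : iota 0 K = index_iota 0 K by rewrite /index_iota subn0.
  apply/funext => -[i j]; rewrite /box /=.
  case: ltnP => iK /=; last first.
    rewrite mulr0 big_mkord big1 // => i' _; rewrite big1_seq // => j' _.
    by rewrite eqn_leq [(i <= i')%N]leqNgt (leq_trans (ltn_ord i') iK) !mul0r mulr0.
  rewrite big_mkord (bigD1 (Ordinal iK)) //= [X in _ + X]big1 ?addr0; last first.
    move=> i' ii'; rewrite big1_seq // => j' _.
    by rewrite -[i]/(val (Ordinal iK)) val_eqE eq_sym (negPf ii') mul0r mulr0.
  rewrite big_mkord eqxx; case: ltnP => jK; last first.
    rewrite mulr0 big1 // => j' _.
    by rewrite eqn_leq [(j <= j')%N]leqNgt (leq_trans (ltn_ord j') jK) mulr0 mulr0.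
  rewrite (bigD1 (Ordinal jK)) //= eqxx !mulr1 big1 ?addr0 // => j' jj'.
  by rewrite -[j]/(val (Ordinal jK)) val_eqE eq_sym (negPf jj') !mulr0.
have M0 : 0 <= M := le_trans (normr_ge0 _) (gM (0%N, 0%N)).
apply/cvgrPdist_lt => eps eps0.
(* M theta <= eps / 4: the tail costs M theta in the limit and at most
   2 M theta along the sequence; the box costs less than eps / 4 *)
pose theta := eps / (4 * (M + 1)).
have M1 : 0 < M + 1 by rewrite ltr_wpDl.
have theta0 : 0 < theta by rewrite divr_gt0 // mulr_gt0.
have Mtheta : M * theta <= eps / 4.
  have -> : eps / 4 = (M + 1) * theta by rewrite /theta; field; rewrite gt_eqF.
  by rewrite ler_pM2r // lerDl.
have [K Kbox] : exists K, `|1 - mean P' S' (fun t => (box K t)%:R)| < theta.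
  have /cvgrPdist_lt/(_ _ theta0)[K _ /(_ K (leqnn K)) Kbox] := box_cvg.
  by exists K.
have box1 t : `|(box K t)%:R : R| <= 1 by case: (box _ _); rewrite ?normr1 ?normr0.
have [_ /cvgrPdist_lt cg] := tbox g K.
have [_ /cvgrPdist_lt cbox] : tested S S' (fun t => (box K t)%:R).
  by rewrite (_ : (fun t => _) = (fun t => 1 * (box K t)%:R)) //; apply/funext => t; rewrite mul1r.
have trunc (dd : measure_display) (Wd : measurableType dd) (Q : probability Wd R)
    (s : Wd -> nat * nat) : (forall t, measurable (s @^-1` [set t])) ->
    `|mean Q s g - mean Q s (fun t => g t * (box K t)%:R)| <=
    M * (1 - mean Q s (fun t => (box K t)%:R)).
  move=> ms.
  have gb t : `|g t * (box K t)%:R| <= M.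
    by rewrite normrM (le_trans _ (gM t)) // ler_piMr.
  have tailM t : `|M + - M * (box K t)%:R| <= M.
    case: (box K t) => /=; first by rewrite mulr1 subrr normr0.
    by rewrite mulr0 addr0 ger0_norm.
  have -> : M * (1 - mean Q s (fun t => (box K t)%:R)) =
      mean Q s (fun t => M + - M * (box K t)%:R).
    have cM (t : nat * nat) : `|M| <= M by rewrite ger0_norm.
    have cB t : `|- M * (box K t)%:R| <= M.
      by case: (box K t); rewrite ?mulr1 ?mulr0 ?normr0 // normrN ger0_norm.
    by rewrite (meanD Q ms cM cB) mean_cst (meanZ Q ms _ box1); ring.
  apply: (mean_dist Q ms gM gb tailM) => t; case: (box K t) => /=.
    by rewrite mulr1 mulr1 !subrr normr0.
  by rewrite !mulr0 subr0 addr0.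
near=> n.
have h1 := trunc _ _ (P n) (@S n) (@mS n).
have h2 := trunc _ _ P' S' mS'.
have h3 : `|mean P' S' (fun t => g t * (box K t)%:R)
            - mean (P n) (@S n) (fun t => g t * (box K t)%:R)| < eps / 4.
  by near: n; apply: cg; rewrite divr_gt0.
have h4 : `|mean P' S' (fun t => (box K t)%:R)
            - mean (P n) (@S n) (fun t => (box K t)%:R)| < theta.
  by near: n; apply: cbox.
have b1 : M * (1 - mean P' S' (fun t => (box K t)%:R)) <= M * theta.
  by rewrite ler_wpM2l //; move: Kbox; rewrite ltr_norml => /andP[_]; apply: ltW.
have b2 : M * (1 - mean (P n) (@S n) (fun t => (box K t)%:R)) <= M * (theta + theta).
  rewrite ler_wpM2l //; move: Kbox h4; rewrite !ltr_norml => /andP[? ?] /andP[? ?].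
  by lra.
move: h1 h2 h3 b1 b2 Mtheta; rewrite mulrDr !ler_norml !ltr_norml.
move=> /andP[? ?] /andP[? ?] /andP[? ?] ? ? ?; apply/andP; split; lra.
Unshelve. all: by end_near. Qed.

End PgfConvergence.

(** * The generating function of the limit law *)

Section PoissonLimit.
Variables (R : realType) (d : measure_display) (W : measurableType d).
Variable P : probability W R.
Implicit Types (Z : {RV P >-> nat}) (A : set W) (a l : R).

Lemma measurable_rv_preimage Z (B : set nat) : measurable (Z @^-1` B).
Proof. by rewrite -[X in measurable X]setTI; apply: measurable_funP. Qed.

(** Used to integrate over the values of one variable at a time, so that independence
    enters only through the joint probabilities of points. *)
Lemma integral_slices Z A (g : nat -> R) (h : W -> R) :
  measurable A -> measurable_fun setT h -> (forall k, 0 <= g k) -> (forall w, 0 <= h w) ->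
  (\int[P]_(w in A) (g (Z w) * h w)%:E =
   \sum_(k <oo) (g k)%:E * \int[P]_(w in A `&` Z @^-1` [set k]) (h w)%:E)%E.
Proof.
move=> mA mh g0 h0.
pose F k := A `&` Z @^-1` [set k].
have mF k : measurable (F k) by apply: measurableI => //; apply: measurable_rv_preimage.
have AF : A = \bigcup_k F k.
  by apply/seteqP; split=> [w Aw|w [k _ []]//]; exists (Z w).
have mgZ : measurable_fun setT (fun w => g (Z w)).
  by apply: (measurable_countable_factor (T := nat)) => k; apply: measurable_rv_preimage.
rewrite {1}AF ge0_integral_bigcup //; first last.
- by move=> j k _ _ [w [[_ /= <-] [_ /= <-]]].
- by move=> w _; rewrite lee_fin mulr_ge0.
- apply/measurable_EFinP; apply: measurable_funTS; exact: measurable_funM.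
apply: eq_eseriesr => k _.
under eq_integral => w /set_mem[_ /= ->] do rewrite EFinM.
rewrite ge0_integralZl_EFin //; first by move=> w _; rewrite lee_fin.
by apply/measurable_EFinP; exact: measurable_funTS.
Qed.

(** The Poisson mass function, also at rate 0, where 0^0 = 1 makes it the point mass
    at 0; poisson_pmf is constantly 1 there. *)
Definition poisson_weight l k : R := l ^+ k / k`!%:R * expR (- l).

Lemma poisson_weight_ge0 l k : 0 <= l -> 0 <= poisson_weight l k.
Proof. by move=> l0; rewrite !mulr_ge0 ?invr_ge0 ?exprn_ge0 ?expR_ge0. Qed.

Lemma is_poissonE l Z k : 0 <= l -> is_poisson l Z ->
  P (Z @^-1` [set k]) = (poisson_weight l k)%:E.
Proof.
rewrite le_eqVlt => /predU1P[<-|l0] /(_ [set k]); rewrite /distribution /pushforward => ->.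
  rewrite /poisson_prob ltxx /poisson_weight oppr0 expR0 mulr1 diracE.
  case: k => [|k]; first by rewrite mem_set // expr0 fact0 divr1.
  by rewrite memNset // exprS !mul0r.
by rewrite /poisson_prob l0 esum_set1 /poisson_pmf l0 // lee_fin poisson_weight_ge0 // ltW.
Qed.

Lemma poisson_pgf a l : 0 <= a -> 0 <= l ->
  (\sum_(k <oo) (a ^+ k)%:E * (poisson_weight l k)%:E = (expR (- ((1 - a) * l)))%:E)%E.
Proof.
move=> a0 l0.
have al0 : 0 <= a * l by rewrite mulr_ge0.
have -> : expR (- ((1 - a) * l)) = expR (- l) * expR (a * l).
  by rewrite -expRD; congr expR; ring.
under eq_eseriesr => k _.
  have -> : ((a ^+ k)%:E * (poisson_weight l k)%:E =
      (expR (- l))%:E * ((a * l) ^+ k / k`!%:R)%:E)%E.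
    by rewrite -!EFinM /poisson_weight exprMn; congr _%:E; ring.
  over.
rewrite /= nneseriesZl/=; last first.
  by move=> n _; rewrite lee_fin divr_ge0// exprn_ge0.
rewrite EFinM; congr (_ * _)%E; rewrite expRE -EFin_lim; last first.
  rewrite /pseries/=; under eq_fun do rewrite mulrC.
  exact: is_cvg_series_exp_coeff.
apply/congr_lim/funext => n/=; rewrite /pseries/= /series/= -sumEFin//.
by under eq_bigr do rewrite mulrC.
Qed.

Variables (Z1 Z2 Z3 : {RV P >-> nat}) (m1 m2 m3 : R).
Hypotheses (m1_ge0 : 0 <= m1) (m2_ge0 : 0 <= m2) (m3_ge0 : 0 <= m3).
Hypotheses (hZ1 : is_poisson m1 Z1) (hZ2 : is_poisson m2 Z2) (hZ3 : is_poisson m3 Z3).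
Hypothesis hZ : mutually_independent (tnth [tuple Z1; Z2; Z3]).

Lemma independent_points i j k :
  P (Z1 @^-1` [set i] `&` Z2 @^-1` [set j] `&` Z3 @^-1` [set k]) =
  (poisson_weight m1 i * poisson_weight m2 j * poisson_weight m3 k)%:E.
Proof.
have := hZ [set: 'I_3]%SET (B := fun v => [set tnth [tuple i; j; k] v]) (fun=> I).
rewrite !big_mkcond /= !big_ord_recl big_ord0 !inE /= mule1.
rewrite !(tnth_nth Z1) !(tnth_nth i) /= 
  (is_poissonE _ m1_ge0 hZ1) (is_poissonE _ m2_ge0 hZ2) (is_poissonE _ m3_ge0 hZ3).
rewrite -!EFinM mulrA => <-.
congr (P _); apply/seteqP; split=> w /=.
  move=> [[w1 w2] w3] v _; rewrite (tnth_nth Z1) (tnth_nth i).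
  by case: v => -[|[|[|//]]] ? /=.
move=> w123; split; first split.
- by have := w123 ord0 (finset.in_setT _); rewrite (tnth_nth Z1) (tnth_nth i).
- by have := w123 (lift ord0 ord0) (finset.in_setT _); rewrite (tnth_nth Z1) (tnth_nth i).
- by have := w123 ord_max (finset.in_setT _); rewrite (tnth_nth Z1) (tnth_nth i).
Qed.

Lemma integral_poisson_pgf (a b c : R) : 0 <= a -> 0 <= b -> 0 <= c ->
  (\int[P]_w (a ^+ Z1 w * (b ^+ Z2 w * (c ^+ Z3 w * 1)))%:E =
  (expR (- ((1 - a) * m1)) * expR (- ((1 - b) * m2)) * expR (- ((1 - c) * m3)))%:E)%E.
Proof.
move=> a0 b0 c0.
have mpow (z : R) Z : measurable_fun setT (fun w => z ^+ Z w).
  by apply: (measurable_countable_factor (T := nat)) => k; apply: measurable_rv_preimage.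
have mc : measurable_fun setT (fun w => c ^+ Z3 w * 1 : R) by apply: measurable_funM.
have mb : measurable_fun setT (fun w => b ^+ Z2 w * (c ^+ Z3 w * 1) : R).
  exact: measurable_funM.
have mZ := measurable_rv_preimage.
rewrite (integral_slices _ _ mb) //; try by [move=> *; rewrite ?mulr_ge0 ?exprn_ge0].
have step3 i j : (\int[P]_(w in Z1 @^-1` [set i] `&` Z2 @^-1` [set j]) (c ^+ Z3 w * 1)%:E =
    (poisson_weight m1 i * poisson_weight m2 j * expR (- ((1 - c) * m3)))%:E)%E.
  rewrite (integral_slices _ (g := fun k => c ^+ k)) //; last 2 first.
  - exact: measurableI.
  - by move=> *; rewrite exprn_ge0.
  rewrite EFinM -(poisson_pgf c0 m3_ge0) -nneseriesZl; last first.
    by move=> k _; rewrite mule_ge0 // lee_fin ?exprn_ge0 ?poisson_weight_ge0.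
  apply: eq_eseriesr => k _; rewrite integral_cst ?mul1e; last first.
    by apply: measurableI => //; apply: measurableI.
  by rewrite /= independent_points muleCA -!EFinM; congr (_%:E); ring.
have step2 i : (\int[P]_(w in Z1 @^-1` [set i]) (b ^+ Z2 w * (c ^+ Z3 w * 1))%:E =
    (poisson_weight m1 i * (expR (- ((1 - b) * m2)) * expR (- ((1 - c) * m3))))%:E)%E.
  rewrite (integral_slices _ (g := fun k => b ^+ k)) //; last 2 first.
  - by move=> *; rewrite exprn_ge0.
  - by move=> *; rewrite mulr1 exprn_ge0.
  under eq_eseriesr => j _ do rewrite step3.
  rewrite [_ * (_ * _)]mulrCA EFinM muleC -(poisson_pgf b0 m2_ge0) -nneseriesZl.
    by apply: eq_eseriesr => j _; rewrite -!EFinM; congr (_%:E); ring.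
  by move=> k _; rewrite mule_ge0 // lee_fin ?exprn_ge0 ?poisson_weight_ge0.
under eq_eseriesr => i _ do rewrite setTI step2.
rewrite -mulrA EFinM muleC -(poisson_pgf a0 m1_ge0) -nneseriesZl.
  by apply: eq_eseriesr => i _; rewrite -!EFinM; congr (_%:E); ring.
by move=> k _; rewrite mule_ge0 // lee_fin ?exprn_ge0 ?poisson_weight_ge0.
Qed.

Let Y (w : W) : nat * nat := ((Z1 w + Z3 w)%N, (Z2 w + Z3 w)%N).

Lemma measurable_poisson_pair (t : nat * nat) : measurable (Y @^-1` [set t]).
Proof.
have -> : Y @^-1` [set t] =
    (fun w => (Z1 w, Z2 w, Z3 w)) @^-1` [set u | (u.1.1 + u.2, u.1.2 + u.2)%N = t].
  by apply/seteqP; split.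
apply: measurable_countable_preimage => -[[i j] k].
have -> : (fun w => (Z1 w, Z2 w, Z3 w)) @^-1` [set (i, j, k)] =
    Z1 @^-1` [set i] `&` Z2 @^-1` [set j] `&` Z3 @^-1` [set k].
  by apply/seteqP; split=> w /= [] => [<- <- <-|[-> ->] ->].
by do 2?apply: measurableI; apply: measurable_rv_preimage.
Qed.

(** The common summand Z3 carries the weight a b. *)
Lemma mean_poisson_pair (a b : R) : 0 <= a <= 1 -> 0 <= b <= 1 ->
  mean P Y (fun t => a ^+ t.1 * b ^+ t.2) =
  expR (- ((1 - a) * (m1 + m3) + (1 - b) * (m2 + m3) - (1 - a) * (1 - b) * m3)).
Proof.
move=> /andP[a0 _] /andP[b0 _]; rewrite /mean unlock.
under eq_integral => w _.
  have -> : ((fun t => a ^+ t.1 * b ^+ t.2) \o Y) w =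
      a ^+ Z1 w * (b ^+ Z2 w * ((a * b) ^+ Z3 w * 1)).
    by rewrite /= !exprD exprMn; ring.
  over.
rewrite integral_poisson_pgf ?mulr_ge0 //= -!expRD; congr expR; ring.
Qed.

End PoissonLimit.

(** * Convergence of the counts of monochromatic hyperedges *)

Lemma expectation_mono_edges (R : realType) (d : measure_display) (W : measurableType d)
    (P : probability W R) (V : finType) (c : nat) (X : V -> {RV P >-> nat})
    (hX : uniform_coloring c X) (r : nat) (L : uhypergraph r V) :
  'E_P[mono_edges L X]%E = (@avg R V c (count_mono R (hyperedges L)))%:E.
Proof.
rewrite (expectation_coloring hX (fun x => (num_mono_edges L x)%:R)).
by congr (_%:E); apply: eq_avg => x; rewrite natr_sum.
Qed.

Lemma covariance_mono_edges (R : realType) (d : measure_display) (W : measurableType d)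
    (P : probability W R) (V : finType) (c : nat) (X : V -> {RV P >-> nat})
    (hX : uniform_coloring c X) (r r' : nat) (L : uhypergraph r V) (L' : uhypergraph r' V) :
  covariance P (mono_edges L X) (mono_edges L' X) =
  (@covar R V c (hyperedges L) (hyperedges L'))%:E.
Proof.
rewrite unlock !(expectation_mono_edges hX) /=.
rewrite (expectation_coloring hX (fun x =>
  ((num_mono_edges L x)%:R - avg (count_mono R (hyperedges L))) *
  ((num_mono_edges L' x)%:R - avg (count_mono R (hyperedges L'))))).
by congr (_%:E); apply: eq_avg => x; rewrite !natr_sum.
Qed.

Theorem mainTheorem2 (R : realType) (r : nat) (hr : (2 <= r)%N)
    (H : nat -> hypermultiplex2 r r)
    (c : nat -> nat) (hc : c n @[n --> \oo] --> \oo)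
    (d : nat -> measure_display) (W : forall n, measurableType (d n))
    (P : forall n, probability (W n) R)
    (X : forall n, vertex (H n) -> {RV (P n) >-> nat})
    (hX : forall n, uniform_coloring (c n) (X n))
    (l1 l2 l12 : R) (hl1 : 0 <= l1) (hl2 : 0 <= l2) (hl12 : 0 <= l12)
    (hl12_1 : l12 <= l1) (hl12_2 : l12 <= l2)
    (T1 := fun n => mono_edges (layer1 (H n)) (X n))
    (T2 := fun n => mono_edges (layer2 (H n)) (X n))
    (hE1 : 'E_(P n)[T1 n]%E @[n --> \oo] --> l1%:E)
    (hE2 : 'E_(P n)[T2 n]%E @[n --> \oo] --> l2%:E)
    (hV1 : 'V_(P n)[T1 n]%E @[n --> \oo] --> l1%:E)
    (hV2 : 'V_(P n)[T2 n]%E @[n --> \oo] --> l2%:E)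
    (hV12 : covariance (P n) (T1 n) (T2 n) @[n --> \oo] --> l12%:E)
    (d' : measure_display) (W' : measurableType d') (P' : probability W' R)
    (Z1 Z2 Z12 : {RV P' >-> nat})
    (hZ1 : is_poisson (l1 - l12) Z1) (hZ2 : is_poisson (l2 - l12) Z2)
    (hZ12 : is_poisson l12 Z12)
    (hZ : mutually_independent (tnth [tuple Z1; Z2; Z12])) :
  cvg_in_distribution P (fun n w => (T1 n w, T2 n w))
    P' (fun w => ((Z1 w + Z12 w)%:R, (Z2 w + Z12 w)%:R) : R * R).
Proof.
pose A n := hyperedges (layer1 (H n)); pose B n := hyperedges (layer2 (H n)).
have Ar n : uniform_edges r (A n) by exact: hyperedges_uniform.
have Br n : uniform_edges r (B n) by exact: hyperedges_uniform.
have c0 n : (0 < c n)%N by case: (hX n).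
have EA : @avg R _ (c n) (count_mono R (A n)) @[n --> \oo] --> l1.
  rewrite (_ : (fun n => _) = fine \o (fun n => 'E_(P n)[T1 n]%E)); first exact: fine_cvg.
  by apply/funext => n /=; rewrite (expectation_mono_edges (hX n)).
have EB : @avg R _ (c n) (count_mono R (B n)) @[n --> \oo] --> l2.
  rewrite (_ : (fun n => _) = fine \o (fun n => 'E_(P n)[T2 n]%E)); first exact: fine_cvg.
  by apply/funext => n /=; rewrite (expectation_mono_edges (hX n)).
have VA : @covar R _ (c n) (A n) (A n) @[n --> \oo] --> l1.
  rewrite (_ : (fun n => _) = fine \o (fun n => 'V_(P n)[T1 n]%E)); first exact: fine_cvg.
  by apply/funext => n /=; rewrite ?/variance (covariance_mono_edges (hX n)).
have VB : @covar R _ (c n) (B n) (B n) @[n --> \oo] --> l2.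
  rewrite (_ : (fun n => _) = fine \o (fun n => 'V_(P n)[T2 n]%E)); first exact: fine_cvg.
  by apply/funext => n /=; rewrite ?/variance (covariance_mono_edges (hX n)).
have VAB : @covar R _ (c n) (A n) (B n) @[n --> \oo] --> l12.
  rewrite (_ : (fun n => _) = fine \o (fun n => covariance (P n) (T1 n) (T2 n))); first exact: fine_cvg.
  by apply/funext => n /=; rewrite ?/variance (covariance_mono_edges (hX n)).
pose N n (x : vertex (H n) -> nat) :=
  (num_mono_edges (layer1 (H n)) x, num_mono_edges (layer2 (H n)) x).
pose S n w := N n (fun v => X n v w).
pose S' w := ((Z1 w + Z12 w)%N, (Z2 w + Z12 w)%N).
have mS n t : measurable (@S n @^-1` [set t]).
  have -> : @S n @^-1` [set t] =
      joint_coloring (X n) @^-1` [set y | N n (fun v => y v) = t].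
    apply/seteqP; split=> w /=; rewrite /S.
      by move=> <-; congr N; apply/funext => v; rewrite ffunE.
    by move=> <-; congr N; apply/funext => v; rewrite ffunE.
  by apply: measurable_countable_preimage => y; exact: measurable_joint_coloring.
have mS' : forall t, measurable (S' @^-1` [set t]) by exact: measurable_poisson_pair.
have pgf (a b : R) : 0 <= a <= 1 -> 0 <= b <= 1 ->
    mean (P n) (@S n) (fun t => a ^+ t.1 * b ^+ t.2) @[n --> \oo] -->
    mean P' S' (fun t => a ^+ t.1 * b ^+ t.2).
  move=> a01 b01.
  rewrite (mean_poisson_pair _ _ _ hZ1 hZ2 hZ12 hZ) ?subr_ge0 // !subrK.
  under eq_fun => n.
    rewrite /mean (expectation_coloring (hX n)
      (fun x => a ^+ (N n x).1 * b ^+ (N n x).2)) /=; over.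
  exact: (pgf_cvg hr c0 hc Ar Br EA EB VA VB VAB a01 b01).
move=> f _ [M fM].
pose g (t : nat * nat) := f (t.1%:R, t.2%:R).
have gM t : `|g t| <= M by exact: fM.
have [EX EY] : (forall n, 'E_(P n)[f \o (fun w => (T1 n w, T2 n w))]%E =
     (mean (P n) (@S n) g)%:E) /\
   'E_P'[f \o (fun w => ((Z1 w + Z12 w)%:R, (Z2 w + Z12 w)%:R))]%E = (mean P' S' g)%:E.
  by split=> [n|]; [rewrite -(expectation_mean _ (@mS n) gM) | rewrite -(expectation_mean _ mS' gM)].
under eq_fun do rewrite EX.
rewrite EY; apply: cvg_EFin; first by near=> n.
exact: cvg_mean_of_pgf gM.
Unshelve. all: by end_near. Qed.
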